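(* Let $\Omega\subset\mathbb{R}^n$ be a bounded domain, $s\in(0,1)$, and $u\in C(\overline\Omega)\cap L^1_s(\mathbb{R}^n)$. Let $\{u^t\}_{t\in[0,T]}$ be a weak field for $u$ in $\Omega$ which is regular by below. Then, if $\mathcal{E}_s(u)<+\infty$, given $F\in C^1(\mathbb{R})$ we have $$\mathcal{E}_{s,F}(u^T)\le\mathcal{E}_{s,F}(u)+\int_{\Omega\cap\{u^T>u\}}\int_{u(x)}^{u^T(x)}\big((-\Delta)^su^t(x)-F'(u^t(x))\big)\Big|_{t=t(x,\lambda)}\,d\lambda\,dx.$$
   Context: Notation: $\Omega^c=\mathbb{R}^n\setminus\Omega$, $Q(\Omega)=(\mathbb{R}^n\times\mathbb{R}^n)\setminus(\Omega^c\times\Omega^c)$. $L^1_s(\mathbb{R}^n)=\{u\in L^1_{\rm loc}(\mathbb{R}^n):\int_{\mathbb{R}^n}\frac{|u(y)|}{1+|y|^{n+2s}}\,dy<+\infty\}$. The fractional Laplacian is $(-\Delta)^su(x)=c_{n,s}\,\mathrm{P.V.}\int_{\mathbb{R}^n}\frac{u(x)-u(y)}{|x-y|^{n+2s}}\,dy$, where $c_{n,s}>0$ is a normalizing constant and $\mathrm{P.V.}$ is the limit as $\varepsilon\downarrow0$ of the integrals over $|x-y|>\varepsilon$ (possibly $-\infty$ here). The energies are $$\mathcal{E}_s(w)=\frac{c_{n,s}}4\iint_{Q(\Omega)}\frac{|w(x)-w(y)|^2}{|x-y|^{n+2s}}\,dx\,dy,\qquad \mathcal{E}_{s,F}(w)=\mathcal{E}_s(w)-\int_\Omega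 F(w(x))\,dx.$$ Weak field: a family $\{u^t\}_{t\in[0,T]}$ of functions $u^t:\mathbb{R}^n\to\mathbb{R}$, nondecreasing in $t$, is a weak field for $u$ in $\Omega$ if: (i) $u^0=u$; (ii) $u^t=u$ a.e. in $\Omega^c$ for all $t\in[0,T]$; (iii) $(x,t)\mapsto u^t(x)$ is continuous in $\overline\Omega\times[0,T]$; (iv) with $I_x=\{t\in(0,T]:u^t(x)>u^0(x)\}$, for each $x\in\Omega$ the function $t\mapsto u^t(x)$ is $C^1(I_x)$ and increasing in $\overline{I_x}$, and there is a constant $C_0>0$ with $0\le\partial_tu^t(x)\le C_0$ for all $x\in\Omega$ and $t\in I_x$. Regular by below: let $\Omega_t=\{x\in\Omega:u^t(x)>u^0(x)\}$. There exist a constant $C_0>0$ and a bounded domain $N\subset\mathbb{R}^n$ with $\overline\Omega\subset N$ such that, for each $t\in(0,T)$ and $x\in\Omega_t$, there is $\psi\in C^2(N)$ with $\psi(x)=u^t(x)$, $\psi\le u^t$ a.e. in $N$, and $D^2\psi\ge-C_0$ in $N$. Leaf-parameter function: for $x\in\Omega$ and $u(x)<\lambda\le u^T(x)$, $t(x,\lambda)\in(0,T]$ is the unique number with $u^{t(x,\lambda)}(x)=\lambda$. The right-hand side of the inequality is allowed to be $-\infty$ a priori: its first term is finite by assumption, and the integrand in the second term is bounded by above. *)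

(* Defs.v *)
From HB Require Import structures.
From mathcomp Require Import all_boot all_order all_algebra.
From mathcomp Require Import all_classical all_reals all_analysis.

Set Implicit Arguments.
Unset Strict Implicit.
Unset Printing Implicit Defensive.
Import Order.TTheory GRing.Theory Num.Theory.
Import numFieldNormedType.Exports.
Local Open Scope classical_set_scope.
Local Open Scope ring_scope.

(* R^n is ['rV[R]_n]; its Borel sets form the sigma-algebra generated by the coordinates. *)
Definition rV_display : measure_display -> measure_display.
Proof. exact. Qed.

Section measurable_rV.
Context {R : realType} {n : nat}.

Definition coord_rV (i : 'I_n) (x : 'rV[R]_n) : R := x ord0 i.

Let rV_set0 : g_sigma_preimage coord_rV set0.
Proof. exact: sigma_algebra0. Qed.

Let rV_setC A : g_sigma_preimage coord_rV A -> g_sigma_preimage coord_rV (~` A).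
Proof. exact: sigma_algebraC. Qed.

Let rV_bigcup (F : (set 'rV[R]_n)^nat) :
  (forall i, g_sigma_preimage coord_rV (F i)) ->
  g_sigma_preimage coord_rV (\bigcup_i F i).
Proof. exact: sigma_algebra_bigcup. Qed.

HB.instance Definition _ := @isMeasurable.Build
  (rV_display default_measure_display)
  'rV[R]_n (g_sigma_preimage coord_rV) rV_set0 rV_setC rV_bigcup.

Lemma measurable_coord_rV (i : 'I_n) : measurable_fun [set: 'rV[R]_n] (coord_rV i).
Proof.
move=> _ Y mY; rewrite setTI; apply: sub_sigma_algebra => /=.
rewrite -bigcup_seq/=; exists i => /=; first by rewrite mem_index_enum.
by exists Y => //; rewrite setTI.
Qed.

Lemma measurable_fun_rVP d (T : measurableType d) (f : T -> 'rV[R]_n) :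
  measurable_fun [set: T] f <->
  forall i, measurable_fun [set: T] (coord_rV i \o f).
Proof.
split=> [mf i|mf]; first exact: measurableT_comp (measurable_coord_rV i) mf.
move=> _; rewrite /measurable/=.
pose G := [set A : set 'rV[R]_n | measurable ([set: T] `&` f @^-1` A)].
suff : g_sigma_preimage coord_rV `<=` G by [].
apply: smallest_sub.
  split; rewrite /G/=.
  - by rewrite preimage_set0 setI0.
  - by move=> A mA; rewrite setTD -preimage_setC setTI; rewrite setTI in mA; exact: measurableC.
  - move=> F mF; rewrite preimage_bigcup setI_bigcupr.
    by apply: bigcupT_measurable => k; exact: mF.
rewrite -bigcup_seq/=; apply: bigcup_sub => i _ A [B mB <-]; rewrite /G/= setTI.
exact: (mf i).
Qed.

End measurable_rV.

Section cons_rV.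
Context {R : realType} {n : nat}.

Definition cons_rV (p : measurableTypeR R * 'rV[R]_n) : 'rV[R]_n.+1 :=
  \row_(i < n.+1) oapp (fun j => p.2 ord0 j) p.1 (unlift ord0 i).

Definition uncons_rV (x : 'rV[R]_n.+1) : measurableTypeR R * 'rV[R]_n :=
  (x ord0 ord0, \row_(j < n) x ord0 (lift ord0 j)).

Lemma uncons_rVK : cancel uncons_rV cons_rV.
Proof.
move=> x; apply/rowP => i; rewrite !mxE/=.
by case: unliftP => [j ->|->]//=; rewrite mxE.
Qed.

Lemma cons_rVK : cancel cons_rV uncons_rV.
Proof.
move=> [a v]; congr pair; first by rewrite mxE unlift_none.
by apply/rowP => j; rewrite !mxE liftK.
Qed.

Lemma measurable_cons_rV : measurable_fun setT cons_rV.
Proof.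
apply/measurable_fun_rVP => i.
have -> : coord_rV i \o cons_rV =
    oapp (fun j => coord_rV j \o snd) fst (unlift ord0 i).
  by apply/funext => p/=; rewrite /coord_rV mxE; case: unlift.
case: (unlift ord0 i) => [j|]/=; last exact: measurable_fst.
apply: measurableT_comp; last exact: measurable_snd.
exact: measurable_coord_rV.
Qed.

Lemma measurable_uncons_rV : measurable_fun setT uncons_rV.
Proof.
apply: measurable_fun_pair; first exact: measurable_coord_rV.
apply/measurable_fun_rVP => i.
have -> : coord_rV i \o (fun x : 'rV[R]_n.+1 => \row_j x ord0 (lift ord0 j)) =
    coord_rV (lift ord0 i) by apply/funext => x; rewrite /coord_rV/= mxE.
exact: measurable_coord_rV.
Qed.

Variable m : {sigma_finite_measure set 'rV[R]_n -> \bar R}.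

Definition cons_measure : set 'rV[R]_n.+1 -> \bar R :=
  pushforward (lebesgue_measure \x m)%E cons_rV.

Let cons_measure0 : cons_measure set0 = 0%E.
Proof. by rewrite /cons_measure/pushforward preimage_set0 measure0. Qed.

Let cons_measure_ge0 A : (0 <= cons_measure A)%E.
Proof. by rewrite /cons_measure/pushforward measure_ge0. Qed.

Let cons_measure_sigma_additive : semi_sigma_additive cons_measure.
Proof.
move=> F mF tF mUF; rewrite /cons_measure/pushforward preimage_bigcup.
apply: measure_semi_sigma_additive.
- by move=> k; rewrite -[X in measurable X]setTI; exact: measurable_cons_rV.
- apply/trivIsetP => /= i j _ _ ij; rewrite -preimage_setI.
  by move/trivIsetP : tF => /(_ _ _ _ _ ij) ->//; rewrite preimage_set0.
- rewrite -preimage_bigcup -[X in measurable X]setTI.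
  exact: measurable_cons_rV.
Qed.

HB.instance Definition _ := isMeasure.Build _ _ _ cons_measure
  cons_measure0 cons_measure_ge0 cons_measure_sigma_additive.

Let cons_measure_sigma_finite : sigma_finite setT cons_measure.
Proof.
have /sigma_finiteP[F [UF ndF Foo]] := sigma_finiteT (@lebesgue_measure R).
have /sigma_finiteP[G [UG ndG Goo]] := sigma_finiteT m.
exists (fun k => uncons_rV @^-1` (F k `*` G k)) => [|k].
  rewrite -preimage_bigcup (_ : \bigcup_k _ = setT) ?preimage_setT//.
  rewrite -subTset -setXTT UF UG => -[x v] [/= [i _ Fix] [j _ Gjv]].
  exists (maxn i j) => //; split.
  - by move: x Fix; exact/subsetPset/ndF/leq_maxl.
  - by move: v Gjv; exact/subsetPset/ndG/leq_maxr.
have [mF Fk] := Foo k; have [mG Gk] := Goo k; split.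
  rewrite -[X in measurable X]setTI.
  by apply: measurable_uncons_rV => //; exact: measurableX.
rewrite /cons_measure/pushforward -comp_preimage.
rewrite (_ : _ \o _ = id) ?preimage_id; last first.
  by apply/funext => p /=; rewrite cons_rVK.
by rewrite product_measure1E// lte_mul_pinfty// ge0_fin_numE.
Qed.

HB.instance Definition _ := Measure_isSigmaFinite.Build _ _ _ cons_measure
  cons_measure_sigma_finite.

End cons_rV.

Fixpoint lebesgue_rV {R : realType} (n : nat) {struct n} :
    {sigma_finite_measure set 'rV[R]_n -> \bar R} :=
  match n with
  | 0 => @dirac _ 'rV[R]_0 0 R
  | n'.+1 => cons_measure (lebesgue_rV n')
  end.

Lemma lebesgue_rV_box (R : realType) n (a b : 'rV[R]_n) :
  (forall i, a ord0 i <= b ord0 i) ->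
  lebesgue_rV n [set x | forall i, a ord0 i <= x ord0 i <= b ord0 i] =
  (\prod_(i < n) (b ord0 i - a ord0 i))%:E.
Proof.
have mbox k (c d : 'rV[R]_k) : measurable
    [set x : 'rV[R]_k | forall i, c ord0 i <= x ord0 i <= d ord0 i].
  rewrite (_ : [set _ | _] = \big[setI/setT]_(i < k)
      (coord_rV i @^-1` `[c ord0 i, d ord0 i]%classic)).
    apply: bigsetI_measurable => i _; rewrite -[X in measurable X]setTI.
    exact: measurable_coord_rV.
  apply/seteqP; split=> x /=; rewrite -bigcap_seq /=.
    by move=> xcd i _ /=; rewrite in_itv/=; exact: xcd.
  by move=> xcd i; have := xcd i; rewrite /= in_itv/=; apply; rewrite mem_index_enum.
elim: n a b => [|n IH] a b ab.
  by rewrite big_ord0 /= diracE mem_set// => -[].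
pose a' : 'rV[R]_n := \row_j a ord0 (lift ord0 j).
pose b' : 'rV[R]_n := \row_j b ord0 (lift ord0 j).
rewrite /= /cons_measure /pushforward.
rewrite (_ : _ @^-1` _ = `[a ord0 ord0, b ord0 ord0]%classic `*`
    [set x : 'rV[R]_n | forall i, a' ord0 i <= x ord0 i <= b' ord0 i]); last first.
  apply/seteqP; split=> -[x v] /=.
    move=> abx; split=> [|i]; first by rewrite in_itv/=; have := abx ord0; rewrite mxE unlift_none.
    by rewrite !mxE; have := abx (lift ord0 i); rewrite mxE liftK.
  move=> [xab vab] i; rewrite mxE; case: unliftP => [j ->|->]/=.
    by have := vab j; rewrite !mxE.
  by rewrite in_itv/= in xab.
rewrite product_measure1E//=; last exact: mbox.
rewrite IH; last by move=> i; rewrite !mxE.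
rewrite lebesgue_measure_itv/= lte_fin big_ord_recl.
under [X in (_ * X%:E)%E]eq_bigr do rewrite !mxE.
have := ab ord0; rewrite le_eqVlt => /predU1P[->|ab0].
  by rewrite ltxx subrr mul0e mul0r.
by rewrite ab0 EFinM EFinB.
Qed.

Section functions_rV.
Context {R : realType} {n : nat}.
Implicit Types (f psi : 'rV[R]_n -> R) (N Omega : set 'rV[R]_n).

(* The library norm on matrices is the sup norm. *)
Definition enorm (x : 'rV[R]_n) : R := Num.sqrt (\sum_(i < n) x ord0 i ^+ 2).

Definition domain Omega :=
  [/\ open Omega, connected Omega & Omega !=set0].

(* Measurability with respect to the completed sigma-algebra.  For such
   functions the library integral against the Borel measure [lebesgue_rV],
   defined as a supremum over simple functions below, is the Lebesgue
   integral. *)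
Definition lebesgue_measurable f :=
  exists2 g : 'rV[R]_n -> R, measurable_fun setT g &
    {ae lebesgue_rV n, forall x, f x = g x}.

Definition L1loc f := lebesgue_measurable f /\
  forall K : set 'rV[R]_n, compact K ->
    (\int[lebesgue_rV n]_(x in K) `|f x|%:E < +oo)%E.

Definition L1s (s : R) f := L1loc f /\
  (\int[lebesgue_rV n]_y (`|f y| / (1 + enorm y `^ (n%:R + 2 * s)))%:E < +oo)%E.

Definition partial (i : 'I_n) f : 'rV[R]_n -> R :=
  fun x => 'D_(delta_mx ord0 i) f x.

Definition C1_on N f := {within N, continuous f} /\
  forall i, (forall x, N x -> derivable f x (delta_mx ord0 i)) /\
            {within N, continuous (partial i f)}.

Definition C2_on N f := C1_on N f /\ forall i, C1_on N (partial i f).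

Definition hessian psi (x : 'rV[R]_n) : 'M[R]_n :=
  \matrix_(i < n, j < n) partial j (partial i psi) x.

(* [A >= b] in the sense of quadratic forms *)
Definition mx_ge (A : 'M[R]_n) (b : R) :=
  forall v : 'rV[R]_n, b * enorm v ^+ 2 <= (v *m A *m v^T) ord0 ord0.

End functions_rV.

Section fractional.
Context {R : realType} {n : nat}.
Variables (c s : R).
Implicit Types (Omega : set 'rV[R]_n) (u w : 'rV[R]_n -> R) (F : R -> R).
Local Open Scope ereal_scope.

Definition frac_laplacian u (x : 'rV[R]_n) : \bar R :=
  c%:E * lim ((\int[lebesgue_rV n]_(y in [set y | (eps < enorm (x - y))%R])
    ((u x - u y) / enorm (x - y) `^ (n%:R + 2 * s))%:E) @[eps --> (0 : R)^'+]).

Definition Qset Omega : set ('rV[R]_n * 'rV[R]_n) :=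
  ~` (~` Omega `*` ~` Omega).

Definition energy Omega w : \bar R :=
  (c / 4)%:E * \int[lebesgue_rV n \x lebesgue_rV n]_(p in Qset Omega)
    (`|w p.1 - w p.2| ^+ 2 / enorm (p.1 - p.2) `^ (n%:R + 2 * s))%:E.

Definition energyF Omega F w : \bar R :=
  energy Omega w - \int[lebesgue_rV n]_(x in Omega) (F (w x))%:E.

End fractional.

Section fields.
Context {R : realType} {n : nat}.
Implicit Types (Omega : set 'rV[R]_n) (T : R) (u : 'rV[R]_n -> R)
  (U : R -> 'rV[R]_n -> R).

(* [dg] is the derivative of [g] on [I], of class C^0 on [I]; it is one-sided
   at an endpoint of the interval [I] that belongs to [I]. *)
Definition C1_with_derivative (I : set R) (g dg : R -> R) :=
  (forall t, I t ->
    (h^-1 * (g (t + h) - g t)) @[h --> within [set h | I (t + h)] 0^'] --> dg t)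
  /\ {within I, continuous dg}.

Definition leaf_times T U (x : 'rV[R]_n) : set R :=
  [set t | 0 < t <= T /\ U 0 x < U t x].

(* Only the values [U t] with [0 <= t <= T] are meaningful. *)
Definition weak_field Omega T u U :=
  [/\ (forall t1 t2, 0 <= t1 -> t1 <= t2 -> t2 <= T ->
        forall x, U t1 x <= U t2 x),
      U 0 = u,
      (forall t, 0 <= t <= T ->
        {ae lebesgue_rV n, forall x, ~ Omega x -> U t x = u x}),
      {within closure Omega `*` `[0, T]%classic,
        continuous (fun p : 'rV[R]_n * R => U p.2 p.1)} &
      exists2 C0 : R, 0 < C0 & forall x, Omega x ->
        let I := leaf_times T U x in
        (forall t1 t2, closure I t1 -> closure I t2 -> t1 < t2 ->
          U t1 x < U t2 x) /\
        exists2 v : R -> R, C1_with_derivative I (U ^~ x) v &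
          forall t, I t -> 0 <= v t <= C0].

Definition regular_by_below Omega T U :=
  exists C0 : R, exists N : set 'rV[R]_n,
    [/\ 0 < C0, domain N, bounded_set N, closure Omega `<=` N &
      forall t x, 0 < t < T -> Omega x -> U 0 x < U t x ->
        exists psi : 'rV[R]_n -> R,
          [/\ C2_on N psi, psi x = U t x,
              {ae lebesgue_rV n, forall y, N y -> psi y <= U t y} &
              forall y, N y -> mx_ge (hessian psi y) (- C0)]].

Definition leaf_parameter T U (x : 'rV[R]_n) (lam : R) : R :=
  xget 0 [set t | 0 < t <= T /\ U t x = lam].

End fields.

(* Main.v *)
Require Import Defs.
From mathcomp Require Import all_boot all_order all_algebra.
From mathcomp Require Import all_classical all_reals all_analysis.
From mathcomp Require Import measurable_realfun.
From mathcomp Require Import ring lra.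

(** The inequality is a calibration argument, and it is an identity as long as
the singularity of the kernel is cut off.

Let [K_e (x, y)] be [|x - y| ^- (n + 2 s)] on [|x - y| > e] and [0] elsewhere,
write [w] for the last leaf [U T], and [E_e] for the energy with kernel [K_e].
For [x] in [Omega] and [u x < l < w x], the leaf through [(x, l)] is [U t] with
[t = t (x, l)].  For a pair [(x, y)], the curve [t |-> (U t x, U t y)] is monotone
in both coordinates, and the two regions which it delimits in the rectangle
[[u x, w x] * [u y, w y]] add up to the rectangle.  This identity of Young
(lemma [leaf_area_young]) only uses that [t] is recovered monotonically from the
values, and no derivative in [t].  It says that the change
[(w x - w y) ^ 2 - (u x - u y) ^ 2] is the sum of
[\int_(u x)^(w x) 2 (l - U (t (x, l)) y) dl] and of the same integral with [x] and
[y] exchanged (lemma [sqr_diff_leaf_density]).  Multiplying by [K_e] and applying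
Fubini, which the cut-off allows, the difference [E_e w - E_e u] becomes the
integral over [x] in [Omega] and [u x < l < w x] of the truncated operator
[c \int_(|x - y| > e) (l - U t y) |x - y| ^- (n + 2 s) dy] at [t = t (x, l)]
(lemmas [leaf_energyE] and [energy_trunc_variation]).

It remains to let [e] tend to [0].  On the left the truncated energies increase
to the energies.  On the right, regularity from below provides a paraboloid
touching the leaf from below at [x], with uniform opening and radius (lemma
[regular_by_below_paraboloid]).  Its linear part does not contribute, by
reflection through [x], and its quadratic part is integrable against the kernel.
Hence the truncated operators decrease with [e] up to an error that tends to
[0]: they converge, possibly to minus infinity, and they are bounded from above
uniformly (lemma [pv_trunc_cvg]).  The reverse Fatou lemma, applied to the
integral in [l] and then to the integral in [x], concludes (lemma
[leaf_energy_inequality]).  It is stated here for integrands that only dominate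
a measurable upper limit, so that the measurability of the fractional Laplacian
along the leaves is never needed.

The leaves are Lebesgue measurable functions.  They are first replaced by Borel
functions that agree with them on [Omega] and almost everywhere (definition
[borel_leaf]); this changes neither the energies nor the truncated operators at
the points of [Omega]. *)

Set Implicit Arguments.
Unset Strict Implicit.
Unset Printing Implicit Defensive.
Import Order.TTheory GRing.Theory Num.Theory.
Import numFieldNormedType.Exports.
Local Open Scope classical_set_scope.
Local Open Scope ring_scope.

(** * Integrals of arbitrary functions and the reverse Fatou lemma *)

Section integral_no_measurability.
Import HBNNSimple.
Local Open Scope ereal_scope.
Context d (T : measurableType d) (R : realType).
Variable mu : {measure set T -> \bar R}.
Implicit Types (f g : T -> \bar R) (D : set T).

(** The integral is defined by a supremum over the simple functions below the
integrand, so that it is monotone without any measurability assumption. *)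
Lemma le_integral_pointwise D f g : (forall x, D x -> f x <= g x) ->
  \int[mu]_(x in D) f x <= \int[mu]_(x in D) g x.
Proof.
move=> fg; have fgD x : (f \_ D) x <= (g \_ D) x.
  by rewrite /patch; case: ifP => // /set_mem; exact: fg.
rewrite /integral; apply: leeB; apply: le_ereal_sup => _ [h hf <-];
  exists h => //= x; apply: le_trans (hf x) _; rewrite ?funeposE ?funenegE.
- by rewrite ge_max !le_max fgD lexx orbT.
- by rewrite ge_max !le_max leeN2 fgD lexx orbT.
Qed.

Let ge0_le_integral_ae D f g : (forall x, D x -> 0 <= f x) ->
  (forall x, D x -> 0 <= g x) ->
  {ae mu, forall x, D x -> f x = g x} ->
  \int[mu]_(x in D) f x <= \int[mu]_(x in D) g x.
Proof.
move=> f0 g0 [N [mN N0 fgN]].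
rewrite ge0_integralE//; apply: ge_ereal_sup => _ [h hf <-].
have -> : sintegral mu h = \int[mu]_x (h x)%:E.
  by rewrite integral_nnsfun// patch_setT.
rewrite (@ge0_negligible_integral _ _ _ mu setT N (EFin \o h))//; last 2 first.
  by apply/measurable_EFinP.
  by move=> x _; rewrite lee_fin.
rewrite integral_mkcond [leRHS]integral_mkcond.
apply: le_integral_pointwise => x _; rewrite /patch.
case: ifPn => [/set_mem [_ Nx]|_].
  have := hf x; rewrite /patch; case: ifPn => [/set_mem Dx|//].
  suff -> : f x = g x by [].
  by move: Dx; apply: contrapT => fg; apply: Nx; apply: fgN.
by case: ifPn => // /set_mem; exact: g0.
Qed.

(** A simple function below [f] can be cut off on a null set without changing
its integral, whence no measurability is needed here either. *)
Lemma ae_eq_integral_pointwise D f g :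
  {ae mu, forall x, D x -> f x = g x} ->
  \int[mu]_(x in D) f x = \int[mu]_(x in D) g x.
Proof.
move=> fg; have gf : {ae mu, forall x, D x -> g x = f x}.
  by apply: filterS fg => x /[apply] ->.
rewrite integralE [RHS]integralE; congr (_ - _); apply/eqP; rewrite eq_le;
  apply/andP; split; apply: ge0_le_integral_ae => //.
- by apply: filterS fg => x /[apply]; rewrite !funeposE => ->.
- by apply: filterS gf => x /[apply]; rewrite !funeposE => ->.
- by apply: filterS fg => x /[apply]; rewrite !funenegE => ->.
- by apply: filterS gf => x /[apply]; rewrite !funenegE => ->.
Qed.

End integral_no_measurability.

Section reverse_fatou.
Local Open Scope ereal_scope.
Context d (T : measurableType d) (R : realType).
Variables (mu : {measure set T -> \bar R}) (D : set T) (mD : measurable D).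

(** The limit [h] need not be measurable, and the upper limit of the [f k] may
be minus infinity. *)
Lemma reverse_fatou (f : nat -> T -> R) (g : T -> R) (h : T -> \bar R) :
  mu.-integrable D (EFin \o g) ->
  (forall k, mu.-integrable D (EFin \o f k)) ->
  (forall k x, D x -> (f k x <= g x)%R) ->
  (forall x, D x -> limn_esup (fun k => (f k x)%:E) <= h x) ->
  limn_esup (fun k => \int[mu]_(x in D) (f k x)%:E) <= \int[mu]_(x in D) h x.
Proof.
move=> ig fi fg fh; pose phi x := limn_esup (fun k => (f k x)%:E).
apply: (@le_trans _ _ (\int[mu]_(x in D) phi x)); last first.
  exact: le_integral_pointwise.
have mphi : measurable_fun D phi.
  by apply: measurable_fun_limn_esup => // k; by case/integrableP: (fi k).
pose G := \int[mu]_(x in D) (g x)%:E.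
have Gfin : G \is a fin_num by exact: integrable_fin_num ig.
pose L := limn_esup (fun k => \int[mu]_(x in D) (f k x)%:E).
have einfE x : limn_einf (fun k => (g x)%:E - (f k x)%:E) = (g x)%:E - phi x.
  by rewrite limn_einf_shift// limn_einfN.
have fat : \int[mu]_(x in D) ((g x)%:E - phi x) <= G - L.
  under eq_integral do rewrite -einfE.
  apply: le_trans (fatou _ _ _ _) _ => //.
  - by move=> k; apply: emeasurable_funB; [by case/integrableP: ig|by case/integrableP: (fi k)].
  - by move=> k x Dx; rewrite sube_ge0 ?orbT// lee_fin fg.
  rewrite -limn_einfN -limn_einf_shift//.
  under eq_fun do rewrite (integralB mD ig (fi _)).
  exact: lexx.
have gphi x : D x -> 0 <= (g x)%:E - phi x.
  move=> Dx; rewrite sube_ge0 ?orbT// /phi limn_esup_lim.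
  apply: lime_le; first exact: is_cvg_esups.
  near=> k; apply: ge_ereal_sup => _ [j /= _ <-]; rewrite lee_fin; exact: fg.
have [oo|fin] := eqVneq (\int[mu]_(x in D) ((g x)%:E - phi x)) +oo.
  suff LNy : L = -oo by rewrite -/L LNy leNye.
  by move: fat Gfin; rewrite oo leye_eq; case: G L => [?||] [?||].
have igphi : mu.-integrable D (fun x => (g x)%:E - phi x).
  apply/integrableP; split.
    by apply: emeasurable_funB => //; by case/integrableP: ig.
  rewrite (eq_integral (fun x => (g x)%:E - phi x)).
    by rewrite ltey.
  by move=> x /set_mem Dx; rewrite gee0_abs// gphi.
have -> : \int[mu]_(x in D) phi x = G - \int[mu]_(x in D) ((g x)%:E - phi x).
  rewrite -integralB//; apply: eq_integral => x _ /=.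
  by case: (phi x) => //= r; rewrite -EFinB; congr EFin; lra.
move: fat Gfin (integrable_fin_num mD igphi); rewrite -/L.
case: (\int[mu]_(x in D) _) G L => [i||] [a||] [l||]//=.
all: by rewrite -?EFinB ?lee_fin ?leNye// => ? ? ?; lra.
Unshelve. all: by end_near. Qed.

End reverse_fatou.


(** * Euclidean norm and Borel sets of row vectors *)

Section row_vectors.
Context {R : realType} {n : nat}.
Implicit Types (x y v : 'rV[R]_n) (A : set 'rV[R]_n).

Lemma coord_le_norm v i : `|v ord0 i| <= `|v|.
Proof.
rewrite [leRHS]/Num.norm/= mx_normrE; apply/bigmax_geP; right.
by exists (ord0, i).
Qed.

Lemma norm_le_coord v (r : R) : 0 <= r -> (forall i, `|v ord0 i| <= r) -> `|v| <= r.
Proof.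
move=> r0 vr; rewrite [leLHS]/Num.norm/= mx_normrE; apply/bigmax_leP; split => //.
by move=> -[i j] _ /=; rewrite ord1.
Qed.

Lemma enorm_ge0 v : 0 <= enorm v.
Proof. exact: sqrtr_ge0. Qed.

Lemma sqr_enorm v : enorm v ^+ 2 = \sum_(i < n) v ord0 i ^+ 2.
Proof. by rewrite sqr_sqrtr// sumr_ge0// => i _; exact: sqr_ge0. Qed.

Lemma coord_le_enorm v i : `|v ord0 i| <= enorm v.
Proof.
rewrite -(@ler_pXn2r _ 2)// ?nnegrE ?enorm_ge0//.
rewrite sqr_enorm real_normK ?num_real// (bigD1 i)//= lerDl.
by rewrite sumr_ge0// => j _; exact: sqr_ge0.
Qed.

Lemma norm_le_enorm v : `|v| <= enorm v.
Proof. by apply: norm_le_coord (enorm_ge0 v) _ => i; exact: coord_le_enorm. Qed.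

Lemma enorm_le_norm v : enorm v <= n%:R * `|v|.
Proof.
rewrite -(@ler_pXn2r _ 2)// ?nnegrE ?enorm_ge0//.
rewrite sqr_enorm exprMn.
apply: (@le_trans _ _ (\sum_(i < n) `|v| ^+ 2)).
  apply: ler_sum => i _; rewrite -real_normK ?num_real//.
  by rewrite ler_pXn2r// ?nnegrE// coord_le_norm.
rewrite sumr_const card_ord -[leLHS]mulr_natl ler_wpM2r ?sqr_ge0//.
by rewrite -natrX ler_nat; case: (n) => // k; rewrite expnS expn1 leq_pmulr.
Qed.

Lemma enormN v : enorm (- v) = enorm v.
Proof. by congr Num.sqrt; apply: eq_bigr => i _; rewrite mxE sqrrN. Qed.

Lemma enormB x y : enorm (x - y) = enorm (y - x).
Proof. by rewrite -enormN opprB. Qed.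

Lemma enorm_eq0 v : enorm v = 0 -> v = 0.
Proof.
move=> v0; apply/eqP; rewrite -normr_le0; rewrite -v0; exact: norm_le_enorm.
Qed.

Lemma enormZ (a : R) v : enorm (a *: v) = `|a| * enorm v.
Proof.
rewrite /enorm; under eq_bigr do rewrite mxE exprMn.
by rewrite -mulr_sumr sqrtrM ?sqr_ge0// sqrtr_sqr.
Qed.

Lemma measurable_enorm : measurable_fun setT (@enorm R n).
Proof.
have msq : measurable_fun setT (fun v : 'rV[R]_n => \sum_(i < n) v ord0 i ^+ 2).
  apply: measurable_sum => i; apply: (measurable_funX (f := coord_rV i)).
  exact: measurable_coord_rV.
apply: measurableT_comp msq.
by apply: continuous_measurable_fun; exact: sqrt_continuous.
Qed.

Lemma measurable_rV_box (a b : 'rV[R]_n) :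
  measurable [set x : 'rV[R]_n | forall i, a ord0 i <= x ord0 i <= b ord0 i].
Proof.
rewrite (_ : [set _ | _] =
    \bigcap_(i in [set: 'I_n]) (coord_rV i @^-1` `[a ord0 i, b ord0 i]%classic)).
  apply: fin_bigcap_measurable => // i _; rewrite -[X in measurable X]setTI.
  exact: measurable_coord_rV.
apply/seteqP; split=> x /=.
  by move=> xab i _ /=; rewrite in_itv/=; exact: xab.
by move=> xab i; have := xab i I; rewrite /= in_itv.
Qed.

(** An open set is the union of the boxes with rational center and radius
[1 / k] that it contains. *)
Lemma open_measurable_rV A : open A -> measurable A.
Proof.
move=> oA.
pose B (q : 'rV[rat]_n * nat) : set 'rV[R]_n :=
  [set x | forall i, ratr (q.1 ord0 i) - q.2.+1%:R^-1 <= x ord0 i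
                     <= ratr (q.1 ord0 i) + q.2.+1%:R^-1].
have mB q : measurable (B q).
  rewrite (_ : B q = [set x | forall i,
    (\row_j (ratr (q.1 ord0 j) - q.2.+1%:R^-1 : R)) ord0 i <= x ord0 i <=
    (\row_j (ratr (q.1 ord0 j) + q.2.+1%:R^-1 : R)) ord0 i]).
    exact: measurable_rV_box.
  by apply/seteqP; split=> x /= xq i; have := xq i; rewrite !mxE.
rewrite (_ : A = \bigcup_q (if `[< B q `<=` A >] then B q else set0)); last first.
  apply/seteqP; split=> [x Ax|x [q _]]; last first.
    by case: ifPn => // /asboolP; apply.
  have /nbhs_ballP[e /= e0 xeA] : nbhs x A by exact: open_nbhs_nbhs.
  have [k ke] : exists k : nat, k.+1%:R^-1 < e / 2.
    exists (Num.bound (e / 2)^-1).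
    rewrite invf_plt ?posrE ?divr_gt0//.
    apply: lt_le_trans (archi_boundP _) _; last by rewrite ler_nat.
    by rewrite invr_ge0 divr_ge0// ltW.
  have qex (i : 'I_n) : exists q : rat, `|x ord0 i - ratr q| <= k.+1%:R^-1.
    have : x ord0 i - k.+1%:R^-1 < x ord0 i + k.+1%:R^-1.
      by rewrite ltrBlDr -addrA ltrDl addr_gt0// invr_gt0.
    move=> /rat_in_itvoo[q]; rewrite in_itv/= => /andP[q1 q2].
    by exists q; rewrite ler_distlC !ltW.
  have [q hq] := choice qex.
  exists (\row_i q i, k) => //=; case: ifPn => [_|/asboolPn].
    move=> i /=; rewrite mxE; have := hq i; rewrite ler_distlC => /andP[].
    move: (k.+1%:R^-1) (ratr _) => d z h1 h2.
    by apply/andP; split; lra.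
  case=> y /= yB; apply: xeA; split => // i j; rewrite ord1.
  rewrite /ball/= /ball_/=.
  have := yB j; rewrite mxE => /andP[y1 y2].
  have := hq j; rewrite ler_distlC => /andP[h1 h2].
  move: y1 y2 h1 h2 ke; move: (k.+1%:R^-1) (ratr _) => d z y1 y2 h1 h2 ke.
  by rewrite ltr_distlC; apply/andP; split; lra.
apply: countable_bigcupT_measurable => // q.
by case: ifPn.
Qed.

Lemma measurable_rV_sub : measurable_fun setT
  (fun p : 'rV[R]_n * 'rV[R]_n => p.1 - p.2).
Proof.
apply/measurable_fun_rVP => i.
rewrite (_ : _ \o _ = fun p : 'rV[R]_n * 'rV[R]_n =>
  coord_rV i p.1 - coord_rV i p.2); last first.
  by apply/funext => p; rewrite /= /coord_rV !mxE.
by apply: measurable_funB; apply: measurableT_comp => //;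
  exact: measurable_coord_rV.
Qed.

Lemma measurable_rV_subl x : measurable_fun setT (fun y => x - y).
Proof.
exact: (measurableT_comp measurable_rV_sub (measurable_pair1 x)).
Qed.

Lemma measurable_euclid_ball x (r : R) : measurable [set y | enorm (x - y) <= r].
Proof.
have mf := measurableT_comp measurable_enorm (measurable_rV_subl x).
have := mf measurableT `]-oo, r]%classic (measurable_itv _).
by rewrite setTI; congr (measurable _); apply/seteqP; split => y /=; rewrite in_itv.
Qed.

Lemma euclid_ball_measure_le x (r : R) : 0 <= r ->
  (lebesgue_rV n [set y | (enorm (x - y) <= r)%R] <= ((2 * r) ^+ n)%:E)%E.
Proof.
move=> r0.
pose a : 'rV[R]_n := \row_i (x ord0 i - r).
pose b : 'rV[R]_n := \row_i (x ord0 i + r).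
apply: (@le_trans _ _ (lebesgue_rV n [set y | forall i, a ord0 i <= y ord0 i <= b ord0 i])).
  apply: le_measure; rewrite ?inE.
  - exact: measurable_euclid_ball.
  - exact: measurable_rV_box.
  - move=> y /= xyr i; rewrite !mxE -ler_distlC.
    by apply: le_trans xyr; have := coord_le_enorm (x - y) i; rewrite !mxE.
rewrite lebesgue_rV_box; last by move=> i; rewrite !mxE; lra.
rewrite lee_fin (eq_bigr (fun=> 2 * r)); last by move=> i _; rewrite !mxE; lra.
by rewrite prodr_const card_ord.
Qed.

End row_vectors.


(** * Invariance of Lebesgue measure by point reflections *)

Section reflection.
Context {R : realType}.
Local Open Scope ereal_scope.

Lemma ge0_integral_reflect1 (a : R) (f : measurableTypeR R -> \bar R) :
  measurable_fun setT f -> (forall r, 0 <= f r) ->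
  \int[lebesgue_measure]_r f (2 * a - r)%R = \int[lebesgue_measure]_r f r.
Proof.
move=> mf f0; pose phi (r : measurableTypeR R) : measurableTypeR R := (2 * a - r)%R.
have mphi : measurable_fun setT phi by exact: measurable_funB.
transitivity (\int[pushforward lebesgue_measure phi]_r f r).
  by rewrite ge0_integral_pushforward.
apply: eq_measure_integral => /= A mA _; apply/esym.
apply: (@lebesgue_measure_unique _ (pushforward lebesgue_measure phi)) => //.
move=> _ [[b c]] _ <-.
transitivity (lebesgue_measure `[(2 * a - c)%R, (2 * a - b)%R[%classic).
  rewrite /= !lebesgue_measure_itv/= !lte_fin.
  rewrite (_ : (2 * a - c < 2 * a - b) = (b < c))%R; last by apply/idP/idP => ?; lra.
  by case: ifP => // _; rewrite -!EFinB; congr EFin; lra.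
congr lebesgue_measure; apply/seteqP; split => r; rewrite /phi/= !in_itv/= => /andP[? ?];
  by apply/andP; split; lra.
Qed.

(** By induction on the dimension, with Tonelli's theorem. *)
Lemma ge0_integral_reflect n (x : 'rV[R]_n) (f : 'rV[R]_n -> \bar R) :
  measurable_fun setT f -> (forall y, 0 <= f y) ->
  \int[lebesgue_rV n]_y f (2%:R *: x - y)%R = \int[lebesgue_rV n]_y f y.
Proof.
elim: n x f => [|n IH] x f mf f0.
  by apply: eq_integral => y _; congr f; rewrite !thinmx0.
pose refl (y : 'rV[R]_n.+1) := (2%:R *: x - y)%R.
have mrefl : measurable_fun setT refl by exact: measurable_rV_subl.
have push (g : 'rV[R]_n.+1 -> \bar R) : measurable_fun setT g -> (forall y, 0 <= g y) ->
    \int[lebesgue_rV n.+1]_y g y =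
    \int[lebesgue_measure]_a \int[lebesgue_rV n]_v g (cons_rV (a, v)).
  move=> mg g0; transitivity
      (\int[pushforward (lebesgue_measure \x lebesgue_rV n) cons_rV]_y g y) => //.
  rewrite ge0_integral_pushforward//; last exact: measurable_cons_rV.
  rewrite preimage_setT fubini_tonelli1//; last by move=> z; exact: g0.
  by apply: measurableT_comp => //; exact: measurable_cons_rV.
pose x0 := x ord0 ord0; pose x' : 'rV[R]_n := \row_j x ord0 (lift ord0 j).
have reflE a v : refl (cons_rV (a, v)) = cons_rV ((2 * x0 - a)%R, (2%:R *: x' - v)%R).
  apply/rowP => i; rewrite !mxE; case: unliftP => [j ->|->]/=; by rewrite ?mxE.
rewrite push//=; last by apply: (measurableT_comp mf mrefl).
transitivity (\int[lebesgue_measure]_a \int[lebesgue_rV n]_v f (cons_rV ((2 * x0 - a)%R, v))).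
  apply: eq_integral => a _.
  under eq_integral do rewrite -/(refl _) reflE.
  rewrite (IH x' (fun v => f (cons_rV ((2 * x0 - a)%R, v))))//.
  apply: measurableT_comp => //; apply: measurableT_comp; first exact: measurable_cons_rV.
  exact: measurable_pair1.
rewrite push// -(@ge0_integral_reflect1 x0 (fun a => \int[lebesgue_rV n]_v f (cons_rV (a, v))))//.
  apply: (measurable_fun_fubini_tonelli_F (fun p => f (cons_rV p))) => //.
  by apply: measurableT_comp => //; exact: measurable_cons_rV.
by move=> r; exact: integral_ge0.
Qed.

End reflection.


(** * Integrals of powers of the distance *)

Section geometric_exhaustion.
Local Open Scope ereal_scope.
Context d (T : measurableType d) (R : realType) (mu : {measure set T -> \bar R}).

(** An integral is controlled by a geometric series when the increments along an
exhaustion are. *)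
Lemma ge0_integral_geometric (E : (set T)^nat) (f : T -> \bar R) (C q : R) :
  (0 <= C)%R -> (0 <= q < 1)%R ->
  (forall k, measurable (E k)) -> nondecreasing_seq E -> E 0%N = set0 ->
  measurable_fun setT f -> (forall x, 0 <= f x) ->
  (forall k, \int[mu]_(x in E k.+1 `\` E k) f x <= (C * q ^+ k)%:E) ->
  \int[mu]_(x in \bigcup_k E k) f x <= (C / (1 - q))%:E.
Proof.
move=> C0 /andP[q0 q1] mE ndE E0 mf f0 fE.
have q1' : (0 < 1 - q)%R by lra.
have bound k : \int[mu]_(x in E k) f x <= (C * (1 - q ^+ k) / (1 - q))%:E.
  elim: k => [|k IH]; first by rewrite E0 integral_set0 expr0 subrr mulr0 mul0r.
  have sub : E k `<=` E k.+1 by rewrite -subsetEset; exact: ndE.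
  rewrite -(setDUK sub) ge0_integral_setU//; last 3 first.
  - exact: measurableD.
  - by rewrite setDUK//; exact: measurable_funS mf.
  - by rewrite disj_set2E setDIK.
  apply: le_trans (leeD IH (fE k)) _.
  rewrite -EFinD lee_fin le_eqVlt; apply/orP; left; apply/eqP.
  by rewrite exprS; field; lra.
have := @ge0_nondecreasing_set_cvg_integral _ _ _ E f mu ndE mE
  (fun i => measurable_funS measurableT (@subsetT _ _) mf) (fun i x _ => f0 x).
move/cvg_lim => <-//; apply: lime_le.
  apply: ereal_nondecreasing_is_cvgn.
  apply: ge0_nondecreasing_set_nondecreasing_integral => //.
  by move=> i; exact: measurable_funS mf.
near=> k; apply: le_trans (bound k) _.
rewrite lee_fin ler_pM2r ?invr_gt0// ler_piMr//.
by rewrite gerBl exprn_ge0.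
Unshelve. all: by end_near. Qed.

End geometric_exhaustion.

Section radial_power.
Context {R : realType} {n : nat}.
Implicit Types (x y : 'rV[R]_n).

(** Spherical shells in the Euclidean norm, open inside and closed outside. *)
Definition annulus x (a b : R) : set 'rV[R]_n := [set y | a < enorm (x - y) <= b].

Lemma measurable_enorm_sub x : measurable_fun setT (fun y => enorm (x - y)).
Proof. exact: (measurableT_comp measurable_enorm (measurable_rV_subl x)). Qed.

Lemma measurable_enorm_itv x (i : interval R) :
  measurable [set y | enorm (x - y) \in i].
Proof.
have := measurable_enorm_sub x measurableT (measurable_itv i).
by rewrite setTI.
Qed.

Lemma measurable_annulus x a b : measurable (annulus x a b).
Proof.
exact: (measurable_enorm_itv x `]a, b]).
Qed.

Lemma measurable_euclid_exterior x a : measurable [set y | a < enorm (x - y)].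
Proof.
have := measurable_enorm_itv x `]a, +oo[.
rewrite (_ : [set y | _] = [set y | a < enorm (x - y)])//.
by apply/seteqP; split => y /=; rewrite in_itv/= andbT.
Qed.

Lemma measurable_radial_power x (b : R) :
  measurable_fun setT (fun y => enorm (x - y) `^ b).
Proof.
apply: (measurableT_comp (f := fun z : R => z `^ b)) (measurable_enorm_sub x).
exact: measurable_powR.
Qed.

(** The shell lies in the cube of side [4 r] centered at [x].  The factor
[1 + 2 `^ b] covers both signs of the exponent. *)
Lemma integral_shell_le x (b r : R) : 0 < r ->
  (\int[lebesgue_rV n]_(y in annulus x r (2 * r)) (enorm (x - y) `^ b)%:E <=
   ((1 + 2 `^ b) * 4 ^+ n * r `^ (b + n%:R))%:E)%E.
Proof.
move=> r0.
have c0 : 0 <= (1 + 2 `^ b) * r `^ b.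
  by rewrite mulr_ge0 ?powR_ge0// addr_ge0// powR_ge0.
apply: (@le_trans _ _ (\int[lebesgue_rV n]_(y in annulus x r (2 * r))
    ((1 + 2 `^ b) * r `^ b)%:E)%E).
  apply: ge0_le_integral => //.
  - exact: measurable_annulus.
  - by move=> y _; rewrite lee_fin powR_ge0.
  - apply/measurable_EFinP; apply: measurable_funS (measurable_radial_power x b) => //.
  - move=> y /= /andP[ry yr]; rewrite lee_fin.
    have [b0|b0] := leP 0 b.
      apply: (@le_trans _ _ ((2 * r) `^ b)).
        by apply: ge0_ler_powR => //; rewrite nnegrE ?enorm_ge0 ?mulr_ge0 ?ltW.
      by rewrite powRM ?(ltW r0)// ler_wpM2r ?powR_ge0// lerDr.
    apply: (@le_trans _ _ (r `^ b)).
      rewrite -[b]opprK !(powRN _ (- b)) lef_pV2 ?posrE ?powR_gt0 ?(lt_trans r0 ry)//.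
      by apply: ge0_ler_powR; rewrite ?nnegrE ?enorm_ge0 ?oppr_ge0 ?(ltW r0) ?(ltW b0) ?(ltW ry).
    by rewrite ler_peMl ?powR_ge0// lerDl powR_ge0.
rewrite integral_cst; last exact: measurable_annulus.
apply: (@le_trans _ _ (((1 + 2 `^ b) * r `^ b)%:E * ((2 * (2 * r)) ^+ n)%:E)%E).
  rewrite lee_wpmul2l ?lee_fin//.
  apply: le_trans (euclid_ball_measure_le x _); last by rewrite mulr_ge0// ltW.
  apply: le_measure; rewrite ?inE.
  - exact: measurable_annulus.
  - exact: measurable_euclid_ball.
  - by move=> y /andP[].
rewrite -EFinM lee_fin (_ : 2 * (2 * r) = 4 * r); last by ring.
rewrite exprMn powRD; last by apply/implyP => _; rewrite gt_eqF.
rewrite powR_mulrn ?(ltW r0)//.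
by rewrite le_eqVlt; apply/orP; left; apply/eqP; ring.
Qed.

Let q_itv (g : R) : 0 < g -> 0 <= 2 `^ (- g) < 1.
Proof.
move=> g0; rewrite powR_ge0/= powRN invf_lt1 ?powR_gt0//.
rewrite -[ltLHS](powRr0 2) /powR; case: ifPn => [/eqP|]; first by lra.
by move=> _; rewrite mul0r ltr_expR mulr_gt0// ln_gt0//; lra.
Qed.

Let shell_factor (b g : R) : R := (1 + 2 `^ b) * 4 ^+ n / (1 - 2 `^ (- g)).

Let cst_ge0 (b : R) : 0 <= (1 + 2 `^ b) * 4 ^+ n.
Proof. by rewrite mulr_ge0 ?exprn_ge0// addr_ge0// powR_ge0. Qed.

(** Dyadic shells shrinking to the center; the constant does not depend on
[x]. *)
Lemma integral_radial_power_near (b : R) : 0 < b + n%:R ->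
  exists2 C, 0 <= C & forall x r, 0 < r ->
  (\int[lebesgue_rV n]_(y in annulus x 0 r) (enorm (x - y) `^ b)%:E <=
   (C * r `^ (b + n%:R))%:E)%E.
Proof.
set g := b + n%:R => g0; exists (shell_factor b g).
  rewrite /shell_factor mulr_ge0// invr_ge0; have := q_itv g0; lra.
move=> x r r0.
pose E k := annulus x (r * 2 ^- k) r.
have <- : \bigcup_k E k = annulus x 0 r.
  apply/seteqP; split => [y [k _] /= /andP[yr yr']|y /= /andP[y0 yr]].
    by rewrite /annulus/= yr' andbT (le_lt_trans _ yr)// mulr_ge0 ?ltW// invr_gt0 exprn_gt0.
  exists (Num.bound (r / enorm (x - y))) => //=; rewrite /E /annulus/= yr andbT.
  rewrite ltr_pdivrMr ?exprn_gt0// -ltr_pdivrMl// mulrC.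
  apply: lt_le_trans (archi_boundP _) _; first by rewrite divr_ge0// ltW.
  by rewrite -natrX ler_nat ltnW// ltn_expl.
have -> : shell_factor b g * r `^ g =
    (1 + 2 `^ b) * 4 ^+ n * r `^ g / (1 - 2 `^ (- g)) by rewrite mulrAC.
apply: ge0_integral_geometric.
- by rewrite mulr_ge0 ?powR_ge0.
- exact: q_itv.
- by move=> k; exact: measurable_annulus.
- apply/nondecreasing_seqP => k; rewrite subsetEset => y /= /andP[yr yr'].
  rewrite /E /annulus/= yr' andbT; apply: le_lt_trans yr.
  rewrite ler_pM2l// lef_pV2 ?posrE ?exprn_gt0//.
  by rewrite exprS ler_peMl ?exprn_ge0//; lra.
- apply/seteqP; split => // y; rewrite /E /annulus/=.
  by rewrite expr0 invr1 mulr1 => /andP[/lt_le_trans/[apply]]; rewrite ltxx.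
- by apply/measurable_EFinP; exact: measurable_radial_power.
- by move=> y; rewrite lee_fin powR_ge0.
- move=> k; have sr0 : 0 < r * 2 ^- k.+1 by rewrite mulr_gt0// invr_gt0 exprn_gt0.
  rewrite (_ : E k.+1 `\` E k = annulus x (r * 2 ^- k.+1) (2 * (r * 2 ^- k.+1))).
    apply: le_trans (integral_shell_le x b sr0) _; rewrite -/g lee_fin -!mulrA.
    rewrite ler_wpM2l ?ler_wpM2l ?exprn_ge0 ?addr_ge0 ?powR_ge0//.
    rewrite powRM ?invr_ge0 ?exprn_ge0 ?(ltW r0)// ler_wpM2l ?powR_ge0//.
    rewrite -powR_invn// -powRrM mulrC powRrM.
    rewrite -powR_mulrn ?powR_ge0// -powRrM -[leRHS]powRrM.
    by apply: ler_powR; rewrite -?natr1; nra.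
  have e2 : 2 * (r * 2 ^- k.+1) = r * 2 ^- k.
    by rewrite exprS invfM; field; rewrite expf_neq0.
  apply/seteqP; split => y; rewrite /E /annulus/= e2.
    move=> [/andP[-> ->]/=]; rewrite andbT => /negP; by rewrite -leNgt.
  move=> /andP[-> yk]; split; last by rewrite ltNge yk.
  apply: le_trans yk _; rewrite ler_piMr ?(ltW r0)// invf_le1 ?exprn_gt0//.
  by rewrite exprn_ege1//; lra.
Qed.

(** Dyadic shells growing to infinity; the constant does not depend on [x]. *)
Lemma integral_radial_power_far (b : R) : b + n%:R < 0 ->
  exists2 C, 0 <= C & forall x r, 0 < r ->
  (\int[lebesgue_rV n]_(y in [set y | (r < enorm (x - y))%R]) (enorm (x - y) `^ b)%:E <=
   (C * r `^ (b + n%:R))%:E)%E.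
Proof.
set g := b + n%:R => g0; exists (shell_factor b (- g)).
  rewrite /shell_factor mulr_ge0// invr_ge0.
  by have := @q_itv (- g); rewrite oppr_gt0 => /(_ g0); lra.
move=> x r r0.
pose E k := annulus x r (r * 2 ^+ k).
have <- : \bigcup_k E k = [set y | r < enorm (x - y)].
  apply/seteqP; split => [y [k _] /= /andP[yr]//|y /= ry].
  exists (Num.bound (enorm (x - y) / r)) => //=; rewrite /E /annulus/= ry /= -ler_pdivrMl// mulrC.
  apply: ltW; apply: lt_le_trans (archi_boundP _) _.
    by rewrite divr_ge0 ?enorm_ge0// ltW.
  by rewrite -natrX ler_nat ltnW// ltn_expl.
have -> : shell_factor b (- g) * r `^ g =
    (1 + 2 `^ b) * 4 ^+ n * r `^ g / (1 - 2 `^ (- - g)) by rewrite mulrAC.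
apply: ge0_integral_geometric.
- by rewrite mulr_ge0 ?powR_ge0.
- by apply: q_itv; rewrite oppr_gt0.
- by move=> k; exact: measurable_annulus.
- apply/nondecreasing_seqP => k; rewrite subsetEset => y /= /andP[ry yr].
  rewrite /E /annulus/= ry/=.
  apply: le_trans yr _; rewrite ler_pM2l//.
  by rewrite exprS ler_peMl ?exprn_ge0//; lra.
- apply/seteqP; split => // y; rewrite /E /annulus/=.
  by rewrite expr0 mulr1 => /andP[/lt_le_trans/[apply]]; rewrite ltxx.
- by apply/measurable_EFinP; exact: measurable_radial_power.
- by move=> y; rewrite lee_fin powR_ge0.
- move=> k; have sr0 : 0 < r * 2 ^+ k by rewrite mulr_gt0// exprn_gt0.
  rewrite (_ : E k.+1 `\` E k = annulus x (r * 2 ^+ k) (2 * (r * 2 ^+ k))).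
    apply: le_trans (integral_shell_le x b sr0) _; rewrite -/g lee_fin -!mulrA.
    rewrite ler_wpM2l ?ler_wpM2l ?exprn_ge0 ?addr_ge0 ?powR_ge0//.
    rewrite powRM ?exprn_ge0 ?(ltW r0)// opprK.
    by rewrite -!powR_mulrn ?powR_ge0// -!powRrM [k%:R * g]mulrC.
  apply/seteqP; split => y; rewrite /E /annulus/= exprS mulrCA.
    by move=> [/andP[-> ->]/=] /negP; rewrite -ltNge andbT.
  move=> /andP[yk ->]; split; last by apply/negP; rewrite negb_and -!ltNge yk orbT.
  rewrite andbT (le_lt_trans _ yk)// ler_peMr ?(ltW r0)//.
  by rewrite exprn_ege1//; lra.
Qed.

End radial_power.


(** * A second-order Taylor inequality *)

Section taylor.
Context {R : realType} {n : nat}.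
Implicit Types (x v h : 'rV[R]_n) (f psi : 'rV[R]_n -> R) (N : set 'rV[R]_n).

Lemma is_derive_cvg (V : normedModType R) (f : V -> R) (a v : V) (l : R) :
  (k^-1 * (f (k *: v + a) - f a)) @[k --> (0 : R)^'] --> l -> is_derive a v f l.
Proof.
move=> fl; apply: DeriveDef; first by apply/cvg_ex; exists l.
exact: cvg_lim fl.
Qed.

Lemma is_derive_line f x v (t : R) : derivable f (x + t *: v) v ->
  is_derive t 1 (fun t => f (x + t *: v)) ('D_v f (x + t *: v)).
Proof.
move=> dfv; apply: is_derive_cvg.
suff -> : (fun k : R => k^-1 * (f (x + (k *: 1 + t) *: v) - f (x + t *: v))) =
    (fun k => k^-1 *: ((f \o shift (x + t *: v)) (k *: v) - f (x + t *: v))) by exact: dfv.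
apply/funext => k /=; congr (_ * (f _ - _)).
by rewrite scalerDl -[k *: 1]/(k * 1) mulr1 addrCA.
Qed.

Lemma line_mvt f x v :
  (forall t : R, 0 <= t <= 1 -> derivable f (x + t *: v) v) ->
  exists2 t, 0 < t < 1 & f (x + v) - f x = 'D_v f (x + t *: v).
Proof.
move=> dfv; pose g (t : R) := f (x + t *: v).
have dg (t : R) : 0 <= t <= 1 -> is_derive t 1 g ('D_v f (x + t *: v)).
  by move=> t01; apply: is_derive_line; exact: dfv.
have cg : {within `[0, 1], continuous g}.
  apply: derivable_within_continuous => t; rewrite in_itv/= => t01.
  by have [] := dg t t01.
have [t|t] := @MVT _ g (fun t => 'D_v f (x + t *: v)) 0 1 ltr01 _ cg.
  by rewrite in_itv/= => /andP[t0 t1]; apply: dg; rewrite !ltW.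
rewrite in_itv/= => t01; rewrite /g scale1r scale0r addr0 subr0 mulr1 => ->.
by exists t.
Qed.

Lemma derivable_scale f x v (c : R) : derivable f x v ->
  derivable f x (c *: v) /\ 'D_(c *: v) f x = c * 'D_v f x.
Proof.
move=> dfv; suff [] : is_derive x (c *: v) f (c * 'D_v f x) by [].
have [->|c0] := eqVneq c 0.
  apply: is_derive_cvg; rewrite mul0r scale0r.
  rewrite (_ : (fun _ => _) = cst 0); first exact: cvg_cst.
  by apply/funext => k; rewrite scaler0 add0r subrr mulr0.
apply: is_derive_cvg.
have : (c * ((k * c)^-1 *: ((f \o shift x) ((k * c) *: v) - f x)))
    @[k --> (0 : R)^'] --> c * 'D_v f x.
  apply: cvgM; first exact: cvg_cst.
  apply: (@cvg_comp _ _ _ (fun k => k * c)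
    (fun k => k^-1 *: ((f \o shift x) (k *: v) - f x)) _ (0:R)^') => //.
  move=> A [e /= e0 eA]; exists (e / `|c|); first by rewrite /= divr_gt0// normr_gt0.
  move=> k /= ke k0; apply: eA => /=; last by rewrite mulf_neq0.
  by move: ke; rewrite !sub0r !normrN normrM ltr_pdivlMr// normr_gt0.
suff -> : (fun k : R => c * ((k * c)^-1 *: ((f \o shift x) ((k * c) *: v) - f x))) =
          (fun k : R => k^-1 * (f (k *: (c *: v) + x) - f x)) by [].
apply/funext => k /=; rewrite scalerA -[_ *: _]/(_ * _) mulrA; congr (_ * _).
by rewrite invfM mulrCA mulfV// mulr1.
Qed.

(** Continuous partial derivatives give a first-order expansion: the coordinates
are incremented one at a time, with the mean value theorem for each. *)
Lemma C1_increment N f x (e : R) : open N -> N x -> C1_on N f -> 0 < e ->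
  exists2 d, 0 < d & forall h, `|h| < d ->
  `|f (x + h) - f x - \sum_(i < n) h ord0 i * partial i f x| <= n%:R * (e * `|h|).
Proof.
move=> oN Nx [_ C1f] e0.
have : \forall z \near x, N z /\ forall i : 'I_n, `|partial i f x - partial i f z| < e.
  apply: filterI; first exact: open_nbhs_nbhs.
  have cpart i : {for x, continuous (partial i f)}.
    have [_ +] := C1f i; rewrite continuous_open_subspace// => /(_ x).
    by apply; rewrite inE.
  have : \forall z \near x, forall i, i \in enum 'I_n ->
      `|partial i f x - partial i f z| < e.
    elim: (enum 'I_n) => [|j s IH]; first by apply: (@filterE _ (nbhs x)) => z i; rewrite in_nil.
    have /cvgrPdist_lt/(_ _ e0) := cpart j; apply: filterS2 IH => z IH hz i.
    by rewrite inE => /predU1P[->//|/IH].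
  by apply: filterS => z hz i; apply: hz; rewrite mem_enum.
move=> /nbhs_ballP[d /= d0 dN]; exists d => // h hd.
(* [hk k] keeps the first [k] coordinates of the increment [h]. *)
pose hk (k : nat) : 'rV[R]_n := \row_i (if (i < k)%N then h ord0 i else 0).
have inball k (j : 'I_n) (t : R) : 0 <= t <= 1 -> k = j :> nat ->
    ball x d (x + hk k + t *: (h ord0 j *: delta_mx ord0 j)).
  move=> /andP[t0 t1] kj; rewrite -ball_normE /ball_/=.
  rewrite -addrA opprD addrA subrr sub0r normrN.
  apply: le_lt_trans hd; apply: norm_le_coord => // i; rewrite !mxE eqxx/=.
  have [->|ij] := eqVneq i j.
    rewrite kj ltnn add0r mulr1 normrM ger0_norm//.
    by apply: le_trans (coord_le_norm h j); rewrite ler_piMl.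
  by rewrite !mulr0 addr0; case: ifP => _; rewrite ?normr0// coord_le_norm.
have step k : (k <= n)%N -> `|f (x + hk k) - f x -
    \sum_(i < n | (i < k)%N) h ord0 i * partial i f x| <= k%:R * (e * `|h|).
  elim: k => [_|k IH kn].
    rewrite big_pred0// subr0 (_ : hk 0%N = 0) ?addr0 ?subrr ?normr0 ?mul0r//.
    by apply/rowP => i; rewrite !mxE.
  pose j := Ordinal kn.
  have hkS : hk k.+1 = hk k + h ord0 j *: delta_mx ord0 j.
    apply/rowP => i; rewrite !mxE eqxx/= ltnS leq_eqVlt.
    have [->|ij] := eqVneq i j; first by rewrite eqxx/= ltnn add0r mulr1.
    by rewrite mulr0 addr0 (_ : (i == k :> nat) = false)//; apply/negbTE.
  have dfj (t : R) : 0 <= t <= 1 ->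
      derivable f (x + hk k + t *: (h ord0 j *: delta_mx ord0 j)) (delta_mx ord0 j).
    move=> t01; have [+ _] := C1f j; apply.
    by have [] := dN _ (inball k j t t01 erefl).
  have [t /andP[t0 t1]] := @line_mvt f (x + hk k) (h ord0 j *: delta_mx ord0 j)
    (fun t t01 => (derivable_scale (h ord0 j) (dfj t t01)).1).
  have t01 : 0 <= t <= 1 by rewrite !ltW.
  rewrite (derivable_scale (h ord0 j) (dfj t t01)).2 -addrA -hkS => fj.
  rewrite (bigD1 j)//= (eq_bigl (fun i : 'I_n => (i < k)%N)); last first.
    move=> i /=; rewrite ltnS [RHS]ltn_neqAle andbC; congr (_ && _).
  have [_ /(_ j)] := dN _ (inball k j t t01 erefl).
  set D := partial j f (_ + _) => pj.
  rewrite (_ : _ - _ = (f (x + hk k) - f x -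
    \sum_(i < n | (i < k)%N) h ord0 i * partial i f x) + h ord0 j * (D - partial j f x)).
    apply: le_trans (ler_normD _ _) _.
    rewrite -natr1 mulrDl mul1r; apply: lerD; first exact: IH (ltnW kn).
    rewrite normrM mulrC; apply: ler_pM => //; last exact: coord_le_norm.
    by rewrite distrC ltW.
  move: fj; rewrite -/(partial j f _) -/D => fj.
  by rewrite mulrBr -fj; ring.
have := step n (leqnn n).
rewrite (_ : hk n = h); last by apply/rowP => i; rewrite mxE ltn_ord.
have -> // : \sum_(i < n | (i < n)%N) h ord0 i * partial i f x =
  \sum_(i < n) h ord0 i * partial i f x.
by apply: eq_bigl => i; rewrite ltn_ord.
Qed.

Lemma C1_is_derive N f x v (t : R) : open N -> N (x + t *: v) -> C1_on N f ->
  is_derive t 1 (fun t => f (x + t *: v))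
    (\sum_(i < n) v ord0 i * partial i f (x + t *: v)).
Proof.
move=> oN Nt C1f; apply: is_derive_cvg; apply/cvgrPdist_le => e e0.
have den : 0 < n%:R * `|v| + 1 by rewrite ltr_wpDl// mulr_ge0.
have [d d0 hd] := C1_increment oN Nt C1f (divr_gt0 e0 den).
near=> k.
have k0 : k != 0 by near: k; exact: nbhs_dnbhs_neq.
have kd : `|k *: v| < d.
  rewrite normrZ; apply: (@le_lt_trans _ _ (`|k| * (`|v| + 1))).
    by rewrite ler_wpM2l// lerDl.
  rewrite -ltr_pdivlMr ?ltr_wpDl//; near: k; apply: dnbhs0_lt.
  by rewrite divr_gt0// ltr_wpDl.
have := hd _ kd.
rewrite (_ : \sum_(i < n) _ = k * \sum_(i < n) v ord0 i * partial i f (x + t *: v)); last first.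
  by rewrite mulr_sumr; apply: eq_bigr => i _; rewrite !mxE mulrA.
set S := \sum_(i < n) _.
rewrite (_ : (k *: 1 + t) *: v = t *: v + k *: v); last first.
  by rewrite scalerDl -[k *: 1]/(k * 1) mulr1 addrC.
rewrite addrA => H.
rewrite distrC -(@ler_pM2l _ `|k|) ?normr_gt0// -normrM.
rewrite mulrBr mulrA mulfV// mul1r; apply: le_trans H _.
apply: (@le_trans _ _ (`|k| * (e * ((n%:R * `|v|) / (n%:R * `|v| + 1))))).
  rewrite normrZ le_eqVlt; apply/orP; left; apply/eqP.
  by move: (n%:R * `|v| + 1)^-1 (n%:R : R) => w m; ring.
by rewrite ler_wpM2l// ler_piMr ?(ltW e0)// ler_pdivrMr// mul1r lerDl.
Unshelve. all: by end_near. Qed.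

(** The sharp constant is [C / 2]; the weaker [C] comes from two uses of the mean
value theorem along the segment, and is enough for an integrable error. *)
Lemma C2_taylor_ge N psi x v (C : R) : open N -> C2_on N psi -> 0 <= C ->
  (forall y, N y -> mx_ge (hessian psi y) (- C)) ->
  (forall t : R, 0 <= t <= 1 -> N (x + t *: v)) ->
  psi x + \sum_(i < n) v ord0 i * partial i psi x - C * enorm v ^+ 2 <= psi (x + v).
Proof.
move=> oN [C1psi C2psi] C0 hess Nv.
pose g (t : R) := psi (x + t *: v).
pose g1 (t : R) := \sum_(i < n) v ord0 i * partial i psi (x + t *: v).
pose g2 (t : R) := (v *m hessian psi (x + t *: v) *m v^T) ord0 ord0.
have dg (t : R) : 0 <= t <= 1 -> is_derive t 1 g (g1 t).
  by move=> t01; apply: C1_is_derive (C1psi) => //; exact: Nv.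
have dg1 (t : R) : 0 <= t <= 1 -> is_derive t 1 g1 (g2 t).
  move=> t01.
  rewrite (_ : g1 = \sum_(i < n) (fun t => v ord0 i * partial i psi (x + t *: v))); last first.
    by apply/funext => z; rewrite fct_sumE.
  rewrite (_ : g2 t = \sum_(i < n) v ord0 i *
      \sum_(j < n) v ord0 j * partial j (partial i psi) (x + t *: v)); last first.
    rewrite /g2 mxE; under eq_bigr do rewrite mxE mulr_suml.
    rewrite exchange_big/=; apply: eq_bigr => i _; rewrite mulr_sumr.
    by apply: eq_bigr => j _; rewrite !mxE; ring.
  apply: is_derive_sum => i.
  have d := C1_is_derive oN (Nv t t01) (C2psi i).
  exact: is_deriveZ.
have cont (k dk : R -> R) : (forall t : R, 0 <= t <= 1 -> is_derive t 1 k (dk t)) ->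
    {within `[0, 1], continuous k}.
  move=> dk'; apply: derivable_within_continuous => t; rewrite in_itv/= => t01.
  by have [] := dk' t t01.
have [t|c] := @MVT _ g g1 0 1 ltr01 _ (cont _ _ dg).
  by rewrite in_itv/= => /andP[t0 t1]; apply: dg; rewrite !ltW.
rewrite in_itv/= => /andP[c0 c1]; rewrite subr0 mulr1 => gc.
have cont1 : {within `[0, c], continuous g1}.
  apply: continuous_subspaceW (cont _ _ dg1).
  by apply: subset_itvl; rewrite bnd_simp ltW.
have [t|b] := @MVT _ g1 g2 0 c c0 _ cont1.
  rewrite in_itv/= => /andP[t0 tc]; apply: dg1; rewrite ltW//= ltW//.
  exact: lt_trans tc c1.
rewrite in_itv/= => /andP[b0 bc]; rewrite subr0 => g1c.
have : - C * enorm v ^+ 2 <= g2 b.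
  by apply: hess; apply: Nv; rewrite (ltW b0)/= (ltW (lt_trans bc c1)).
have e2 := sqr_ge0 (enorm v).
move=> g2b; move: gc; rewrite /g scale1r scale0r addr0.
have : g1 0 = \sum_(i < n) v ord0 i * partial i psi x.
  by rewrite /g1 scale0r addr0.
move=> <- gc.
have : - C * enorm v ^+ 2 <= g2 b * c.
  apply: (@le_trans _ _ (- C * enorm v ^+ 2 * c)); last by rewrite ler_pM2r.
  by rewrite !mulNr lerN2; apply: ler_piMr; [exact: mulr_ge0|exact: ltW].
by rewrite -g1c; lra.
Qed.

End taylor.


(** * Truncated principal values *)

Section principal_value.
Context {R : realType} {n : nat}.
Variable p : R.
Hypothesis p_itv : n%:R < p < n%:R + 2.
Implicit Types (x y : 'rV[R]_n) (v G : 'rV[R]_n -> R).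
Local Notation mu := (lebesgue_rV n).
Local Notation exterior x e := [set y | e < enorm (x - y)].

Let p_gt0 : 0 < p.
Proof. by move: p_itv => /andP[+ _]; apply: le_lt_trans. Qed.

(** The kernel of the operator, with value [0] on the diagonal (inverse of [0]). *)
Definition riesz x y : R := (enorm (x - y) `^ p)^-1.

Lemma riesz_ge0 x y : 0 <= riesz x y.
Proof. by rewrite invr_ge0 powR_ge0. Qed.

Lemma rieszE x y : riesz x y = enorm (x - y) `^ (- p).
Proof. by rewrite powRN. Qed.

Lemma riesz_sym x y : riesz x y = riesz y x.
Proof. by rewrite /riesz enormB. Qed.

Lemma measurable_riesz x : measurable_fun setT (riesz x).
Proof.
rewrite (_ : riesz x = fun y => enorm (x - y) `^ (- p)).
  exact: measurable_radial_power.
by apply/funext => y; rewrite rieszE.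
Qed.

Lemma measurable_riesz2 : measurable_fun setT
  (fun q : 'rV[R]_n * 'rV[R]_n => riesz q.1 q.2).
Proof.
rewrite (_ : (fun q => _) =
    (fun z : R => z `^ (- p)) \o (enorm \o (fun q : 'rV[R]_n * 'rV[R]_n => q.1 - q.2))).
  apply: measurableT_comp; first exact: measurable_powR.
  exact: measurableT_comp measurable_enorm measurable_rV_sub.
by apply/funext => q; rewrite rieszE.
Qed.

Lemma riesz_tail_le (M e : R) : 0 <= M -> 0 < e -> exists2 C, 0 <= C &
  forall x y, `|x| <= M -> e < enorm (x - y) -> riesz x y <= C / (1 + enorm y `^ p).
Proof.
move=> M0 e0; pose a := n%:R * (M / e + 1).
have a0 : 0 <= a by rewrite mulr_ge0// addr_ge0// divr_ge0// ltW.
exists (e `^ (- p) + a `^ p) => [|x y xM exy].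
  by rewrite addr_ge0// powR_ge0.
have xy0 : 0 < enorm (x - y) by exact: lt_trans exy.
have den : 0 < 1 + enorm y `^ p by rewrite ltr_pwDl// powR_ge0.
rewrite ler_pdivlMr// /riesz mulrC ler_pdivrMr ?powR_gt0// mulrDl; apply: lerD.
  rewrite powRN mulrC ler_pdivlMr ?powR_gt0// mul1r.
  by apply: ge0_ler_powR; rewrite ?nnegrE ?enorm_ge0 ?(ltW e0) ?(ltW p_gt0) ?(ltW exy).
rewrite -powRM// ?enorm_ge0//.
have a' : 0 <= a * enorm (x - y) by rewrite mulr_ge0 ?enorm_ge0.
apply: ge0_ler_powR; rewrite ?nnegrE ?a' ?enorm_ge0 ?(ltW p_gt0)//.
apply: le_trans (enorm_le_norm y) _; rewrite /a -mulrA ler_wpM2l//.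
have -> : y = x - (x - y) by rewrite subKr.
apply: le_trans (ler_normB _ _) _; rewrite subKr mulrDl mul1r; apply: lerD.
  by rewrite mulrAC ler_pdivlMr// ler_pM// ltW.
exact: norm_le_enorm.
Qed.

Lemma integral_riesz_far : exists2 C, 0 <= C & forall x e, 0 < e ->
  (\int[mu]_(y in exterior x e) (riesz x y)%:E <= (C * e `^ (n%:R - p))%:E)%E.
Proof.
have [|C C0 HC] := @integral_radial_power_far R n (- p).
  by move: p_itv; lra.
exists C => // x e e0; have := HC x e e0; rewrite addrC => h.
by apply: le_trans h; under eq_integral do rewrite rieszE.
Qed.

(** Away from the diagonal, the truncated integrals of all functions dominated by
a fixed [G] with integrable tail are bounded uniformly in [x]. *)
Lemma pv_dominated (M M0 e : R) G : 0 <= M -> 0 <= M0 -> 0 < e ->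
  measurable_fun setT G ->
  (\int[mu]_y (`|G y| / (1 + enorm y `^ p))%:E < +oo)%E ->
  exists2 C, 0 <= C & forall x v, `|x| <= M -> measurable_fun setT v ->
    `|v x| <= M0 -> (forall y, `|v y| <= `|G y|) ->
    mu.-integrable (exterior x e) (EFin \o (fun y => (v x - v y) * riesz x y)) /\
    (\int[mu]_(y in exterior x e) `|((v x - v y) * riesz x y)%:E| <= C%:E)%E.
Proof.
move=> M_ge0 M0_ge0 e0 mG Goo.
have [C1 C1_ge0 far] := integral_riesz_far.
have [C2 C2_ge0 tail] := riesz_tail_le M_ge0 e0.
pose g y := `|G y| / (1 + enorm y `^ p).
have g0 y : 0 <= g y by rewrite divr_ge0// addr_ge0// powR_ge0.
have mg : measurable_fun setT g.
  apply: measurable_funM; first exact: measurableT_comp.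
  rewrite (_ : (fun y => _) = (fun y => (1 + enorm y `^ p) `^ (-1))); last first.
    by apply/funext => y; rewrite powR_inv1// addr_ge0// powR_ge0.
  apply: (measurableT_comp (f := fun z : R => z `^ (-1))); first exact: measurable_powR.
  apply: measurable_funD => //.
  apply: (measurableT_comp (f := fun z : R => z `^ p)) measurable_enorm.
  exact: measurable_powR.
pose B := fine (\int[mu]_y (g y)%:E).
have BE : (\int[mu]_y (g y)%:E = B%:E)%E.
  by rewrite fineK// ge0_fin_numE// integral_ge0// => y _; rewrite lee_fin.
have B0 : 0 <= B by rewrite fine_ge0// integral_ge0// => y _; rewrite lee_fin.
exists (M0 * (C1 * e `^ (n%:R - p)) + C2 * B) => [|x v xM mv vx vG].
  by rewrite addr_ge0 ?mulr_ge0 ?powR_ge0.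
have mD : measurable (exterior x e) by exact: measurable_euclid_exterior.
have mf : measurable_fun (exterior x e) (fun y => (v x - v y) * riesz x y).
  apply: (measurable_funS measurableT) => //.
  apply: measurable_funM; last exact: measurable_riesz.
  by apply: measurable_funB.
have bound : (\int[mu]_(y in exterior x e) `|((v x - v y) * riesz x y)%:E| <=
    (M0 * (C1 * e `^ (n%:R - p)) + C2 * B)%:E)%E.
  apply: (@le_trans _ _ (\int[mu]_(y in exterior x e)
      ((M0 * riesz x y)%:E + (C2 * g y)%:E))%E).
    apply: le_integral_pointwise => y /= exy.
    rewrite -EFinD lee_fin normrM (ger0_norm (riesz_ge0 x y)).
    apply: (@le_trans _ _ ((M0 + `|G y|) * riesz x y)).
      rewrite ler_wpM2r ?riesz_ge0//; apply: le_trans (ler_normB _ _) _.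
      exact: lerD.
    rewrite mulrDl lerD2l /g mulrCA; apply: ler_wpM2l => //.
    exact: tail.
  rewrite ge0_integralD//; last 4 first.
  - by move=> y _; rewrite lee_fin mulr_ge0// riesz_ge0.
  - apply/measurable_EFinP/(measurable_funS measurableT) => //.
    by apply: measurable_funM => //; exact: measurable_riesz.
  - by move=> y _; rewrite lee_fin mulr_ge0.
  - apply/measurable_EFinP/(measurable_funS measurableT) => //.
    by apply: measurable_funM.
  rewrite EFinD; apply: leeD.
    under eq_integral do rewrite EFinM.
    rewrite ge0_integralZl_EFin//; last 2 first.
    - by move=> y _; rewrite lee_fin riesz_ge0.
    - apply/measurable_EFinP/(measurable_funS measurableT) => //.
      exact: measurable_riesz.
    by rewrite EFinM lee_wpmul2l ?lee_fin// far.
  under eq_integral do rewrite EFinM.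
  rewrite ge0_integralZl_EFin//; last 2 first.
  - by move=> y _; rewrite lee_fin.
  - by apply/measurable_EFinP/(measurable_funS measurableT).
  rewrite EFinM lee_wpmul2l ?lee_fin// -BE.
  apply: ge0_subset_integral => //; first exact/measurable_EFinP.
  by move=> y _; rewrite lee_fin.
split; last exact: bound.
apply/integrableP; split; first exact/measurable_EFinP.
by apply: le_lt_trans bound _; rewrite ltry.
Qed.


Lemma annulus_measure_lty x (a b : R) : (mu (annulus x a b) < +oo)%E.
Proof.
apply: (@le_lt_trans _ _ (mu [set y | (enorm (x - y) <= `|b|)%R])).
  apply: le_measure; rewrite ?inE; [exact: measurable_annulus|exact: measurable_euclid_ball|].
  by move=> y /andP[_ yb]; apply: le_trans yb (ler_norm b).
by apply: le_lt_trans (euclid_ball_measure_le x (normr_ge0 b)) _; rewrite ltry.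
Qed.

Lemma riesz_le x y (e : R) : 0 < e -> e < enorm (x - y) -> riesz x y <= e `^ (- p).
Proof.
move=> e0 exy; rewrite powRN lef_pV2 ?posrE ?powR_gt0 ?(lt_trans e0 exy)//.
by apply: ge0_ler_powR; rewrite ?nnegrE ?enorm_ge0 ?(ltW e0) ?(ltW p_gt0) ?(ltW exy).
Qed.

Lemma bounded_annulus_integrable x (a b c : R) (f : 'rV[R]_n -> R) : 0 < a ->
  measurable_fun setT f -> (forall y, annulus x a b y -> `|f y| <= c) ->
  mu.-integrable (annulus x a b) (EFin \o (fun y => f y * riesz x y)).
Proof.
move=> a0 mf fc; apply: measurable_bounded_integrable.
- exact: measurable_annulus.
- exact: annulus_measure_lty.
- apply: (measurable_funS measurableT) => //.
  by apply: measurable_funM => //; exact: measurable_riesz.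
- exists (c * a `^ (- p)); split; first exact: num_real.
  move=> z /ltW hz y /= yab; apply: le_trans hz.
  rewrite normrM (ger0_norm (riesz_ge0 x y)); apply: ler_pM => //.
  + exact: riesz_ge0.
  + exact: fc.
  + by apply: riesz_le => //; case/andP: yab.
Qed.

Let lin x (D : 'I_n -> R) y : R := \sum_(i < n) (y - x) ord0 i * D i.

Let measurable_lin x D : measurable_fun setT (lin x D).
Proof.
apply: measurable_sum => i; apply: measurable_funM => //.
rewrite (_ : (fun y => _) = fun y : 'rV[R]_n => coord_rV i y - x ord0 i).
  by apply: measurable_funB => //; exact: measurable_coord_rV.
by apply/funext => y; rewrite !mxE.
Qed.

Let lin_integrable x D (a b : R) : 0 < a ->
  mu.-integrable (annulus x a b) (EFin \o (fun y => lin x D y * riesz x y)).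
Proof.
move=> a0; apply: (@bounded_annulus_integrable x a b (\sum_(i < n) b * `|D i|)) => //.
move=> y /andP[_ yb]; apply: le_trans (ler_norm_sum _ _ _) _; apply: ler_sum => i _.
rewrite normrM ler_wpM2r//; apply: le_trans (coord_le_enorm _ _) _.
by rewrite enormB.
Qed.

(** By reflection through [x], the linear part of a function does not
contribute to its integral over an annulus centred at [x]. *)
Lemma integral_annulus_linear x (D : 'I_n -> R) (a b : R) : 0 < a ->
  (\int[mu]_(y in annulus x a b)
    ((\sum_(i < n) (y - x) ord0 i * D i) * riesz x y)%:E = 0)%E.
Proof.
move=> a0; have int := lin_integrable x D b a0.
pose f y := (lin x D y * riesz x y)%:E.
rewrite -[LHS]/(\int[mu]_(y in annulus x a b) f y)%E.
have mA := measurable_annulus x a b.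
have mf : measurable_fun setT f.
  by apply/measurable_EFinP; apply: measurable_funM => //; exact: measurable_riesz.
rewrite integralE.
have fin : (\int[mu]_(y in annulus x a b) f^\+ y \is a fin_num)%E.
  exact: integrable_pos_fin_num.
suff -> : (\int[mu]_(y in annulus x a b) f^\- y = \int[mu]_(y in annulus x a b) f^\+ y)%E.
  by rewrite subee.
rewrite integral_mkcond [RHS]integral_mkcond.
rewrite -[RHS](@ge0_integral_reflect _ _ x); last 2 first.
- apply/(measurable_restrictT _ mA); apply: (measurable_funS measurableT) => //.
  exact: measurable_funepos.
- by move=> y; rewrite /patch; case: ifP => // _; exact: funepos_ge0.
apply: eq_integral => y _.
have e1 : x - (2%:R *: x - y) = - (x - y).
  by apply/rowP => i; rewrite !mxE; ring.
have e2 : (2%:R *: x - y) - x = - (y - x).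
  by apply/rowP => i; rewrite !mxE; ring.
rewrite /patch; have -> : (2%:R *: x - y \in annulus x a b) = (y \in annulus x a b).
  by apply/idP/idP; rewrite !inE /annulus/= e1 enormN.
case: ifP => // _; rewrite funenegE funeposE /f -EFinN; congr (maxe _%:E _).
rewrite -mulNr /riesz e1 enormN; congr (_ * _).
rewrite /lin -sumrN; apply: eq_bigr => i _; rewrite e2 [in RHS]mxE.
by rewrite mulNr.
Qed.

(** Effect on an annulus of a paraboloid touching [v] from below at [x]: only its
quadratic part remains. *)
Lemma integral_annulus_le x (v : 'rV[R]_n -> R) (D : 'I_n -> R) (C a b : R) :
  0 < a -> 0 <= C ->
  {ae mu, forall y, enorm (x - y) <= b ->
    v x + \sum_(i < n) (y - x) ord0 i * D i - C * enorm (x - y) ^+ 2 <= v y} ->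
  (\int[mu]_(y in annulus x a b) ((v x - v y) * riesz x y)%:E <=
   C%:E * \int[mu]_(y in annulus x a b) (enorm (x - y) `^ (2 - p))%:E)%E.
Proof.
move=> a0 C0 vge.
pose h y := - lin x D y * riesz x y + C * (enorm (x - y) ^+ 2 * riesz x y).
have mA := measurable_annulus x a b.
have sq y : annulus x a b y -> enorm (x - y) ^+ 2 * riesz x y = enorm (x - y) `^ (2 - p).
  move=> /andP[ay _]; have y0 := lt_trans a0 ay.
  rewrite rieszE powRD; last by rewrite (gt_eqF y0) implybT.
  by rewrite -powR_mulrn ?enorm_ge0.
apply: (@le_trans _ _ (\int[mu]_(y in annulus x a b) (h y)%:E)%E).
  rewrite (@ae_eq_integral_pointwise _ _ _ _ _ _
      (fun y => (Num.min ((v x - v y) * riesz x y) (h y))%:E)).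
    by apply: le_integral_pointwise => y _; rewrite lee_fin ge_min lexx orbT.
  apply: filterS vge => y vy /andP[_ yb]; congr EFin; apply/esym/min_idPl.
  rewrite /h mulrA -mulrDl ler_wpM2r ?riesz_ge0//.
  by have := vy yb; rewrite -/(lin x D y); lra.
have isq : mu.-integrable (annulus x a b) (EFin \o (fun y => enorm (x - y) ^+ 2 * riesz x y)).
  apply: (@bounded_annulus_integrable x a b (b ^+ 2)) => //.
    apply: measurable_funX; exact: measurable_enorm_sub.
  move=> y /andP[ay yb]; have y0 := ltW (lt_trans a0 ay).
  rewrite ger0_norm ?sqr_ge0// ler_pXn2r// nnegrE//; exact: le_trans yb.
have linN y : - lin x D y = lin x (fun i => - D i) y.
  by rewrite /lin -sumrN; apply: eq_bigr => i _; rewrite mulrN.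
have inl : mu.-integrable (annulus x a b) (EFin \o (fun y => - lin x D y * riesz x y)).
  rewrite (_ : _ \o _ = EFin \o (fun y => lin x (fun i => - D i) y * riesz x y)).
    exact: lin_integrable.
  by apply/funext => y /=; rewrite linN.
rewrite /h; under eq_integral do rewrite EFinD.
rewrite (integralD mA inl); last first.
  by under [X in integrable _ _ X]eq_fun do rewrite EFinM; exact: integrableZl.
rewrite [X in (X + _ <= _)%E](_ : _ = 0%E); last first.
  rewrite -[RHS](integral_annulus_linear x (fun i => - D i) b a0).
  by apply: eq_integral => y _ /=; rewrite linN.
rewrite add0e; under eq_integral do rewrite EFinM.
rewrite (integralZl mA isq) (eq_integral (fun y => (enorm (x - y) `^ (2 - p))%:E))//.
by move=> y /set_mem ya; rewrite -sq.
Qed.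

(** The truncated integrals whose limit is the principal value. *)
Definition pv_trunc v x (e : R) : \bar R :=
  (\int[mu]_(y in exterior x e) ((v x - v y) * riesz x y)%:E)%E.

(** One-sided control by a paraboloid: up to the integrable error
[C |x - y| ^ (2 - p)] the truncated integrals decrease with the radius, so that
they have a limit and are bounded from above by the one at radius [r]. *)
Lemma pv_trunc_cvg : exists2 C1, 0 <= C1 &
  forall x v (D : 'I_n -> R) (C r : R), 0 <= C -> 0 < r ->
  measurable_fun setT v ->
  (forall e, 0 < e -> mu.-integrable (exterior x e)
    (EFin \o (fun y => (v x - v y) * riesz x y))) ->
  {ae mu, forall y, enorm (x - y) <= r ->
    v x + \sum_(i < n) (y - x) ord0 i * D i - C * enorm (x - y) ^+ 2 <= v y} ->
  cvg (pv_trunc v x e @[e --> 0^'+]) /\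
  forall e, 0 < e <= r ->
    (pv_trunc v x e <= pv_trunc v x r + (C * (C1 * r `^ (n%:R + 2 - p)))%:E)%E.
Proof.
have [|C1 C1_ge0 near0] := @integral_radial_power_near R n (2 - p).
  by move: p_itv; lra.
have gE : 2 - p + n%:R = n%:R + 2 - p by ring.
rewrite gE in near0; exists C1 => // x v D C r C0 r0 mv iv vge.
pose L := pv_trunc v x.
pose b (e : R) := (\int[mu]_(y in annulus x 0 e) (enorm (x - y) `^ (2 - p))%:E)%E.
have b0 e : (0 <= b e)%E by apply: integral_ge0 => y _; rewrite lee_fin powR_ge0.
have bE e : 0 < e -> b e \is a fin_num.
  by move=> e0; rewrite ge0_fin_numE//; apply: le_lt_trans (near0 x e e0) _; rewrite ltry.
have LE e : 0 < e -> L e \is a fin_num.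
  move=> e0; apply: integrable_fin_num (iv e e0); exact: measurable_euclid_exterior.
have mpow A : measurable_fun A (fun y => (enorm (x - y) `^ (2 - p))%:E).
  apply/measurable_EFinP/(measurable_funS measurableT) => //.
  exact: measurable_radial_power.
have step a e : 0 < a -> a <= e -> e <= r -> (L a + C%:E * b a <= L e + C%:E * b e)%E.
  move=> a0 ae er.
  have -> : L a = (L e + \int[mu]_(y in annulus x a e) ((v x - v y) * riesz x y)%:E)%E.
    rewrite /L /pv_trunc -integral_setU.
    - congr (integral _ _ _); apply/seteqP; split => y /=; rewrite /annulus/=.
        by move=> ay; case: (ltP e (enorm (x - y))) => ye; [left|right; rewrite ay].
      by move=> [/(le_lt_trans ae)//|/andP[]].
    - exact: measurable_euclid_exterior.
    - exact: measurable_annulus.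
    - apply/measurable_EFinP/(measurable_funS measurableT) => //.
      apply: measurable_funM; last exact: measurable_riesz.
      exact: measurable_funB.
    - rewrite disj_set2E; apply/eqP/seteqP; split => // y [/= ey /andP[_]].
      by rewrite leNgt ey.
  have -> : b e = (b a + \int[mu]_(y in annulus x a e) (enorm (x - y) `^ (2 - p))%:E)%E.
    rewrite /b -ge0_integral_setU//.
    - congr (integral _ _ _); apply/seteqP; split => y /=; rewrite /annulus/=.
        by move=> /andP[y0 ye]; case: (leP (enorm (x - y)) a) => ya; [left|right]; rewrite ?y0.
      move=> [/andP[-> /le_trans->//]|/andP[ya ->]].
      by rewrite (lt_trans a0 ya).
    - exact: measurable_annulus.
    - exact: measurable_annulus.
    - by move=> y _; rewrite lee_fin powR_ge0.
    - rewrite disj_set2E; apply/eqP/seteqP; split => // y [/= /andP[_ ya] /andP[ay _]].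
      by move: ya; rewrite leNgt ay.
  have i0 : (0 <= \int[mu]_(y in annulus x a e) (enorm (x - y) `^ (2 - p))%:E)%E.
    by apply: integral_ge0 => y _; rewrite lee_fin powR_ge0.
  rewrite (ge0_muleDr _ (b0 a) i0).
  have : (\int[mu]_(y in annulus x a e) ((v x - v y) * riesz x y)%:E <=
      C%:E * \int[mu]_(y in annulus x a e) (enorm (x - y) `^ (2 - p))%:E)%E.
    apply: integral_annulus_le => //.
    by apply: filterS vge => y hy ye; apply: hy; exact: le_trans er.
  move: (\int[mu]_(y in _) _)%E (C%:E * _)%E (L e) (C%:E * b a)%E => I J Le B IJ.
  by rewrite -addeA (addeC I); apply: leeD2l; exact: leeD2l.
split; last first.
  move=> e /andP[e0 er]; apply: le_trans (leeDl _ _) (le_trans (step e r e0 er (lexx r)) _).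
    by rewrite mule_ge0// lee_fin.
  by apply: leeD2l; rewrite EFinM lee_wpmul2l ?lee_fin// near0.
(* With the quadratic correction, the truncated integrals are monotone. *)
pose Mf e := (L e + C%:E * b e)%E.
have Mcvg : Mf e @[e --> (0:R)^'+] --> ereal_inf (Mf @` `]0, r]%classic).
  apply: nondecreasing_at_right_cvge => //.
  by move=> a e; rewrite !in_itv/= => /andP[a0 _] /andP[_ er] ae; exact: step.
have bcvg : (C%:E * b e)%E @[e --> (0:R)^'+] --> 0%E.
  have up : ((C * (C1 * e `^ (n%:R + 2 - p)))%:E)%E @[e --> (0:R)^'+] --> 0%E.
    apply: cvg_EFin; first exact: nearW.
    rewrite [X in _ --> X](_ : _ = C * (C1 * 0)); last by rewrite /= !mulr0.
    apply: cvgM; first exact: cvg_cst.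
    apply: cvgM; first exact: cvg_cst.
    by apply: powR_cvg0; move: p_itv; lra.
  apply: squeeze_cvge up; last exact: cvg_cst.
  near=> e; rewrite mule_ge0 ?lee_fin//=.
  rewrite EFinM lee_wpmul2l ?lee_fin//.
  by apply: near0; near: e; exact: nbhs_right_gt.
apply/cvg_ex; exists (ereal_inf (Mf @` `](0%R : R), r]%classic) - 0)%E.
apply: cvg_trans (cvgeB _ Mcvg bcvg); last by rewrite fin_num_adde_defl// fin_numN.
apply: near_eq_cvg; near=> e.
have e0 : (0 < e)%R by near: e; exact: nbhs_right_gt.
by rewrite /Mf addeK// fin_numM// bE.
Unshelve. all: by end_near. Qed.

End principal_value.


(** * Leaf fields and Young's identity *)

Lemma measurable_set_lt d (X : measurableType d) (R : realType) (f g : X -> R) :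
  measurable_fun setT f -> measurable_fun setT g -> measurable [set z | f z < g z].
Proof.
move=> mf mg; have := measurable_fun_ltr mf mg measurableT (Y := [set true]).
by rewrite setTI; apply.
Qed.

(** The data of a field of functions with leaf parameter [tau], after
modification on a null set so that each leaf is Borel: [Om] is the bounded set
on which the field moves, [M] bounds both [Om] and the leaves on it. *)
Record leaf_field (R : realType) (n : nat) (Om : set 'rV[R]_n) (T M : R)
    (V : R -> 'rV[R]_n -> R) (tau : 'rV[R]_n -> R -> R) : Prop := LeafField {
  lf_T_ge0 : 0 <= T;
  lf_M_ge0 : 0 <= M;
  lf_measurable_set : measurable Om;
  lf_set_bounded : forall x, Om x -> `|x| <= M;
  lf_measurable : forall t : R, 0 <= t <= T -> measurable_fun setT (V t);
  lf_exterior : forall (t : R) y, 0 <= t <= T -> ~ Om y -> V t y = V 0 y;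
  lf_nondecreasing : forall (t1 t2 : R) y, 0 <= t1 -> t1 <= t2 -> t2 <= T -> V t1 y <= V t2 y;
  lf_left_continuous : forall (t : R) y a, 0 < t <= T -> a < V t y ->
    exists2 q : rat, 0 <= (ratr q : R) < t & a < V (ratr q) y;
  lf_bounded : forall y, Om y -> `|V 0 y| <= M /\ `|V T y| <= M;
  lf_leaf : forall x l, Om x -> V 0 x < l < V T x ->
    0 < tau x l < T /\ V (tau x l) x = l;
  lf_leaf_gt : forall x l (q : R), Om x -> V 0 x < l < V T x -> 0 <= q <= T ->
    (q < tau x l) = (V q x < l);
  lf_leaf_lt : forall x l (q : R), Om x -> V 0 x < l < V T x -> 0 <= q <= T ->
    (tau x l < q) = (l < V q x)
}.

Section leaf_field_theory.
Context {R : realType} {n : nat}.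
Variables (Om : set 'rV[R]_n) (T M : R) (V : R -> 'rV[R]_n -> R).
Variable tau : 'rV[R]_n -> R -> R.
Hypothesis lf : leaf_field Om T M V tau.
Local Notation lambda := (@lebesgue_measure R).
Local Notation u := (V 0).
Local Notation w := (V T).
Implicit Types (x y : 'rV[R]_n) (l : R).

Let T0 : 0 <= (0 : R) <= T. Proof. by rewrite lexx (lf_T_ge0 lf). Qed.
Let TT : 0 <= T <= T. Proof. by rewrite lexx (lf_T_ge0 lf). Qed.

Lemma lf_uw x : u x <= w x.
Proof. by apply: (lf_nondecreasing lf); rewrite ?lexx// (lf_T_ge0 lf). Qed.

(** The pairs of a point and a value swept there by the field. *)
Definition swept : set ('rV[R]_n * measurableTypeR R) :=
  [set z | Om z.1 /\ u z.1 < z.2 < w z.1].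

Lemma measurable_swept : measurable swept.
Proof.
rewrite (_ : swept = fst @^-1` Om `&`
    ([set z | u z.1 < z.2] `&` [set z | z.2 < w z.1])); last first.
  by apply/seteqP; split => z /=; rewrite /swept/=; [case=> ? /andP[]|case=> ? [-> ->]].
apply: measurableI; last apply: measurableI.
- rewrite -[X in measurable X]setTI; apply: measurable_fst => //.
  exact: lf_measurable_set lf.
- apply: measurable_set_lt; last exact: measurable_snd.
  by apply: measurableT_comp => //; exact: lf_measurable lf _ T0.
- apply: measurable_set_lt; first exact: measurable_snd.
  by apply: measurableT_comp => //; exact: lf_measurable lf _ TT.
Qed.

(** The increment at [y], from the initial function, of the leaf through
[(x, l)]. *)
Definition leaf_incr x y l : R :=
  if `[< swept (x, l) >] then V (tau x l) y - u y else 0.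

Lemma leaf_time_itv x l : swept (x, l) -> 0 <= tau x l <= T.
Proof.
move=> [/= Ox xl]; have [/andP[t0 t1] _] := lf_leaf lf Ox xl.
by rewrite !ltW.
Qed.

Lemma leaf_incr_ge0 x y l : 0 <= leaf_incr x y l.
Proof.
rewrite /leaf_incr; case: ifPn => // /asboolP sw.
have /andP[t0 tT] := leaf_time_itv sw.
by rewrite subr_ge0; apply: (lf_nondecreasing lf).
Qed.

Lemma leaf_incr_le x y l : leaf_incr x y l <= w y - u y.
Proof.
rewrite /leaf_incr; case: ifPn => [/asboolP sw|_]; last by rewrite subr_ge0 lf_uw.
have /andP[t0 tT] := leaf_time_itv sw.
by rewrite lerD2r; apply: (lf_nondecreasing lf).
Qed.

Lemma leaf_incr_exterior x y l : ~ Om y -> leaf_incr x y l = 0.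
Proof.
move=> Oy; rewrite /leaf_incr; case: ifPn => // /asboolP /leaf_time_itv tT.
by rewrite (lf_exterior lf tT Oy) subrr.
Qed.

(* An enumeration of the rational times of the field; the default [0] gives the
   increment [0] below. *)
Let rtime (k : nat) : R :=
  if unpickle k is Some q then (if 0 <= (ratr q : R) <= T then ratr q else 0) else 0.

Let rtime_itv k : 0 <= rtime k <= T.
Proof. by rewrite /rtime; case: unpickle => // q; case: ifPn. Qed.

Let rincr k (z : 'rV[R]_n * 'rV[R]_n * measurableTypeR R) : R :=
  \1_[set z | swept (z.1.1, z.2) /\ V (rtime k) z.1.1 < z.2] z *
    (V (rtime k) z.1.2 - u z.1.2).

Let measurable_rincr k : measurable_fun setT (rincr k).
Proof.
have mV1 t : 0 <= t <= T -> measurable_fun setT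
    (fun z : 'rV[R]_n * 'rV[R]_n * measurableTypeR R => V t z.1.1).
  move=> tT; apply: (measurableT_comp (lf_measurable lf tT)).
  exact: measurableT_comp.
have mV2 t : 0 <= t <= T -> measurable_fun setT
    (fun z : 'rV[R]_n * 'rV[R]_n * measurableTypeR R => V t z.1.2).
  move=> tT; apply: (measurableT_comp (lf_measurable lf tT)).
  exact: measurableT_comp.
apply: measurable_funM; last by apply: measurable_funB; apply: mV2.
apply: measurable_indic; apply: measurableI; last first.
  by apply: measurable_set_lt => //; exact: mV1.
have mg : measurable_fun setT
    (fun z : 'rV[R]_n * 'rV[R]_n * measurableTypeR R => (z.1.1, z.2)).
  by apply: measurable_fun_pair => //; exact: measurableT_comp.
by have := mg measurableT _ measurable_swept; rewrite setTI.
Qed.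

(** The leaf through [(x, l)] is the supremum of the leaves at the rational times
[q] with [V q x < l]. *)
Lemma measurable_leaf_incr : measurable_fun setT
  (fun z : 'rV[R]_n * 'rV[R]_n * measurableTypeR R => leaf_incr z.1.1 z.1.2 z.2).
Proof.
apply/measurable_EFinP.
rewrite (_ : _ \o _ = fun z => esups (fun k => (rincr k z)%:E) 0).
  by apply: measurable_fun_esups => k; apply/measurable_EFinP; exact: measurable_rincr.
apply/funext => -[[x y] l] /=; apply/eqP; rewrite eq_le; apply/andP; split; last first.
  apply: ge_ereal_sup => _ [k _ <-]; rewrite lee_fin /rincr indicE/=.
  have [/set_mem[/= sw Vl]|] := boolP (_ \in _); last by rewrite mul0r leaf_incr_ge0.
  rewrite mul1r /leaf_incr; case: ifPn => [_|/asboolPn//].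
  rewrite lerD2r; have /andP[r0 rT] := rtime_itv k.
  have [/= Ox xl] := sw; have /andP[t0 tT] := leaf_time_itv sw.
  apply: (lf_nondecreasing lf) => //; apply: ltW.
  by rewrite (lf_leaf_gt lf Ox xl (rtime_itv k)).
apply/lee_addgt0Pr => e e0.
rewrite /leaf_incr; case: ifPn => [/asboolP sw|_]; last first.
  apply: (@le_trans _ _ (rincr 0 (x, y, l))%:E); last first.
    rewrite -[leLHS]adde0; apply: leeD; last by rewrite lee_fin ltW.
    by apply: ereal_sup_ubound; exists 0%N.
  rewrite lee_fin /rincr/= mulr_ge0// subr_ge0.
  have /andP[r0 rT] := rtime_itv 0.
  exact: (lf_nondecreasing lf).
have [/= Ox xl] := sw; have [/andP[t0 tT] Vx] := lf_leaf lf Ox xl.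
have [||q /andP[q0 qt] Vq] := @lf_left_continuous _ _ _ _ _ _ _ lf (tau x l) y
  (V (tau x l) y - e).
- by rewrite t0 ltW.
- by rewrite ltrBlDr ltrDl.
have qT : 0 <= (ratr q : R) <= T by rewrite q0/= ltW// (lt_trans qt).
have rq : rtime (pickle q) = ratr q by rewrite /rtime pickleK qT.
apply: (@le_trans _ _ ((rincr (pickle q) (x, y, l))%:E + e%:E)); last first.
  by apply: leeD2r; apply: ereal_sup_ubound; exists (pickle q).
rewrite -EFinD lee_fin /rincr indicE mem_set /= ?rq.
  by rewrite mul1r; lra.
by split => //=; rewrite -(lf_leaf_gt lf Ox xl qT).
Qed.

(** The area of the part of the rectangle [[u x, w x] * [u y, w y]] that lies under
the curve [t |-> (V t x, V t y)]. *)
Definition leaf_area x y : \bar R := (\int[lambda]_l (leaf_incr x y l)%:E)%E.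

Lemma leaf_area_ge0 x y : (0 <= leaf_area x y)%E.
Proof. by apply: integral_ge0 => l _; rewrite lee_fin leaf_incr_ge0. Qed.

Lemma measurable_leaf_area : measurable_fun setT
  (fun z : 'rV[R]_n * 'rV[R]_n => leaf_area z.1 z.2).
Proof.
apply: (measurable_fun_fubini_tonelli_F
  (fun z : 'rV[R]_n * 'rV[R]_n * measurableTypeR R => (leaf_incr z.1.1 z.1.2 z.2)%:E)).
- by apply/measurable_EFinP; exact: measurable_leaf_incr.
- by move=> z; rewrite lee_fin leaf_incr_ge0.
Qed.

Lemma measurable_leaf_incr_r x y : measurable_fun setT (fun l : measurableTypeR R => leaf_incr x y l).
Proof.
apply: (measurableT_comp (f := fun z : 'rV[R]_n * 'rV[R]_n * measurableTypeR R =>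
  leaf_incr z.1.1 z.1.2 z.2) (g := fun l : measurableTypeR R => ((x, y), l))).
  exact: measurable_leaf_incr.
exact: measurable_pair1.
Qed.

Lemma leaf_area0 x y : ~ Om x \/ ~ Om y -> leaf_area x y = 0%E.
Proof.
move=> Oxy; rewrite /leaf_area integral0_eq// => l _; congr EFin.
case: Oxy => [Ox|]; last exact: leaf_incr_exterior.
by rewrite /leaf_incr; case: ifPn => // /asboolP[].
Qed.

Let itvlen (a b : R) : a <= b -> lambda `]a, b[%classic = (b - a)%:E.
Proof.
move=> ab; rewrite lebesgue_measure_itv/= lte_fin; case: ltP => // ba.
by rewrite (_ : b = a) ?subrr//; apply/eqP; rewrite eq_le ab ba.
Qed.

(** Young's identity: the two regions delimited in a rectangle by the curve
[t |-> (V t x, V t y)] add up to the rectangle. *)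
Lemma leaf_area_young x y :
  (leaf_area x y + leaf_area y x = ((w x - u x) * (w y - u y))%:E)%E.
Proof.
have ext z : ~ Om z -> w z - u z = 0.
  by move=> Oz; rewrite (lf_exterior lf TT Oz) subrr.
have [Ox|Ox] := pselect (Om x); last first.
  by rewrite (leaf_area0 (or_introl Ox)) (leaf_area0 (or_intror Ox)) (ext x Ox) mul0r adde0.
have [Oy|Oy] := pselect (Om y); last first.
  by rewrite (leaf_area0 (or_introl Oy)) (leaf_area0 (or_intror Oy)) (ext y Oy) mulr0 adde0.
(* The region under the curve: its vertical sections have length
   [leaf_incr x y], and its horizontal ones [w x - u x - leaf_incr y x]. *)
pose S := [set z : measurableTypeR R * measurableTypeR R |
  [/\ swept (x, z.1), swept (y, z.2) & V (tau y z.2) x < z.1]].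
(* Both sides say that the leaf through [(y, b)] precedes the one through
   [(x, a)]. *)
have sweptP a b : swept (x, a) -> swept (y, b) ->
    (V (tau y b) x < a) = (b < V (tau x a) y).
  move=> [/= _ xa] [/= _ yb].
  have tb : 0 <= tau y b <= T by apply: leaf_time_itv.
  have ta : 0 <= tau x a <= T by apply: leaf_time_itv.
  by rewrite -(lf_leaf_gt lf Ox xa tb) -(lf_leaf_lt lf Oy yb ta).
have msw z : measurable [set l : measurableTypeR R | swept (z, l)].
  have := @measurable_pair1 _ _ 'rV[R]_n (measurableTypeR R) z measurableT _ measurable_swept.
  by rewrite setTI.
have mS : measurable S.
  rewrite (_ : S = (fst @^-1` [set l : measurableTypeR R | swept (x, l)] `&`
      snd @^-1` [set l : measurableTypeR R | swept (y, l)]) `&`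
      [set z | leaf_incr y x z.2 + u x < z.1]); last first.
    apply/seteqP; split => -[a b] /=; rewrite /S/= /leaf_incr.
      by move=> [sx sy xy]; split => //; case: ifPn => [_|/asboolPn//]; rewrite subrK.
    move=> [[sx sy] xy]; split => //; move: xy.
    by case: ifPn => [_|/asboolPn//]; rewrite subrK.
  apply: measurableI; first apply: measurableI.
  - by rewrite -[X in measurable X]setTI; apply: measurable_fst.
  - by rewrite -[X in measurable X]setTI; apply: measurable_snd.
  apply: measurable_set_lt; last exact: measurable_fst.
  apply: measurable_funD => //.
  by apply: (measurableT_comp (measurable_leaf_incr_r y x)); exact: measurable_snd.
have ux : u x <= w x by exact: lf_uw.
have uy : u y <= w y by exact: lf_uw.
have vert a : (\int[lambda]_b (\1_S (a, b))%:E = (leaf_incr x y a)%:E)%E.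
  rewrite integral_indic// ?setIT; last first.
    have := @measurable_pair1 _ _ (measurableTypeR R) (measurableTypeR R) a measurableT _ mS.
    by rewrite setTI.
  rewrite /leaf_incr; case: ifPn => [/asboolP sw|/asboolPn sw]; last first.
    rewrite (_ : (fun b => S (a, b)) = set0) ?measure0//.
    by apply/seteqP; split => // b /= [].
  have ta := leaf_time_itv sw; have /andP[ta0 taT] := ta.
  have c1 : u y <= V (tau x a) y by apply: (lf_nondecreasing lf).
  have c2 : V (tau x a) y <= w y by apply: (lf_nondecreasing lf).
  rewrite -itvlen//; congr (lambda _); apply/seteqP; split => b; rewrite /S/= in_itv/=.
    move=> [_ sy]; rewrite sweptP// => ->; rewrite andbT.
    by case: sy => /= _ /andP[].
  move=> /andP[yb bt]; have sy : swept (y, b).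
    by split => //=; rewrite yb (lt_le_trans bt).
  by split => //; rewrite sweptP.
have horiz b : (\int[lambda]_a (\1_S (a, b))%:E =
    (if `[< swept (y, b) >] then w x - u x - leaf_incr y x b else 0)%:E)%E.
  rewrite integral_indic// ?setIT; last first.
    have := @measurable_pair2 _ _ (measurableTypeR R) (measurableTypeR R) b measurableT _ mS.
    by rewrite setTI.
  case: ifPn => [/asboolP sw|/asboolPn sw]; last first.
    rewrite (_ : (fun a => S (a, b)) = set0) ?measure0//.
    by apply/seteqP; split => // a /= [].
  have tb := leaf_time_itv sw; have /andP[tb0 tbT] := tb.
  have c1 : u x <= V (tau y b) x by apply: (lf_nondecreasing lf).
  have c2 : V (tau y b) x <= w x by apply: (lf_nondecreasing lf).
  rewrite /leaf_incr; case: ifPn => [_|/asboolPn//].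
  rewrite (_ : _ - _ = w x - V (tau y b) x); last by ring.
  rewrite -itvlen//; congr (lambda _); apply/seteqP; split => a; rewrite /S/= in_itv/=.
    by move=> [[/= _ /andP[_ ->]] _ ->].
  move=> /andP[xa aw]; split => //; split => //=.
  by rewrite aw (le_lt_trans c1).
have -> : leaf_area x y = (\int[lambda]_b
    (if `[< swept (y, b) >] then w x - u x - leaf_incr y x b else 0)%:E)%E.
  rewrite /leaf_area; under eq_integral do rewrite -vert.
  rewrite (fubini_tonelli (fun z => (\1_S z)%:E))//; last first.
    by apply/measurable_EFinP; exact: measurable_indic.
  by apply: eq_integral => b _; rewrite -horiz.
rewrite /leaf_area -ge0_integralD//; last 4 first.
- move=> b _; rewrite lee_fin; case: ifPn => // _.
  by rewrite subr_ge0 leaf_incr_le.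
- apply/measurable_EFinP; rewrite (_ : (fun _ => _) = fun b : measurableTypeR R =>
    \1_[set l | swept (y, l)] b * (w x - u x - leaf_incr y x b)); last first.
    apply/funext => b; rewrite indicE; case: ifPn => [/asboolP sw|/asboolPn sw].
      by rewrite mem_set// mul1r.
    by rewrite memNset// mul0r.
  apply: measurable_funM; first exact: measurable_indic.
  by apply: measurable_funB => //; exact: measurable_leaf_incr_r.
- by move=> b _; rewrite lee_fin leaf_incr_ge0.
- by apply/measurable_EFinP; exact: measurable_leaf_incr_r.
transitivity (\int[lambda]_(b in `]u y, w y[%classic) (w x - u x)%:E)%E.
  rewrite [RHS]integral_mkcond; apply: eq_integral => b _.
  rewrite patchE; case: ifPn => [/asboolP sw|/asboolPn sw].
    rewrite mem_set; first by rewrite -EFinD; congr EFin; ring.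
    by case: sw => /= _; rewrite in_itv.
  rewrite /leaf_incr (asboolF sw) adde0 memNset//= in_itv/= => yb.
  exact: sw.
transitivity ((w x - u x)%:E * lambda `]u y, w y[%classic)%E.
  exact: integral_cst.
by rewrite itvlen.
Qed.

End leaf_field_theory.


(** * The variation of the truncated energy *)

Section ftc_open_interval.
Context {R : realType}.
Local Notation lambda := (@lebesgue_measure R).

Lemma integral_derive1_oo (F : R -> R) (a b : R) : a <= b ->
  (forall z, derivable F z 1) -> continuous (derive1 F) ->
  lambda.-integrable `]a, b[%classic (EFin \o derive1 F) /\
  (\int[lambda]_(z in `]a, b[%classic) (derive1 F z)%:E = (F b - F a)%:E)%E.
Proof.
move=> ab dF cF; have cf : {within `[a, b], continuous (derive1 F)}.
  exact: continuous_subspaceT.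
have cF0 : continuous F.
  by move=> z; apply: differentiable_continuous; exact/derivable1_diffP.
have int : lambda.-integrable `[a, b] (EFin \o derive1 F).
  by apply: continuous_compact_integrable => //; exact: segment_compact.
split; first by apply: integrableS int => //; exact: subset_itv_oo_cc.
move: ab; rewrite le_eqVlt => /predU1P[->|ab].
  by rewrite set_itvoo0 integral_set0 subrr.
rewrite -(integral_itv_bndoo true false); last first.
  apply: (@measurable_funS _ _ _ _ `[a, b]%classic) => //; first exact: subset_itv_oo_cc.
  by case/integrableP: int.
rewrite EFinB; apply: (continuous_FTC2 ab cf) => //.
split => // [|]; first exact: cvg_at_right_filter (cF0 a).
exact: cvg_at_left_filter (cF0 b).
Qed.

Lemma integral_affine_oo (a b c : R) : a <= b ->
  lambda.-integrable `]a, b[%classic (EFin \o (fun z => z - c)) /\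
  (\int[lambda]_(z in `]a, b[%classic) (z - c)%:E =
    ((b - a) * (b + a - 2 * c) / 2)%:E)%E.
Proof.
move=> ab; pose F (z : R) := (z - c) ^+ 2 / 2.
have dF (z : R) : is_derive z (1 : R) F (z - c).
  apply: is_derive_eq; rewrite scaler0 scaler0 add0r subr0 /GRing.scale/=.
  by field.
have F'E : derive1 F = fun z => z - c.
  by apply/funext => z; rewrite derive1E; exact: derive_val.
have [||int val] := @integral_derive1_oo F a b ab.
- by move=> z; exact: ex_derive.
- by rewrite F'E; move=> z; apply: cvgB; [exact: cvg_id|exact: cvg_cst].
rewrite F'E in int val; split; first exact: int.
by rewrite val; congr EFin; rewrite /F; field.
Qed.

End ftc_open_interval.

Lemma integral_twice_sum d (X : measurableType d) (R : realType)
    (mu : {measure set X -> \bar R}) (f g : X -> \bar R) (r : R) :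
  mu.-integrable setT f -> mu.-integrable setT g ->
  (\int[mu]_x f x = r%:E)%E -> (\int[mu]_x g x = r%:E)%E ->
  (\int[mu]_x (2%:E * (f x + g x)) = (4 * r)%:E)%E.
Proof.
move=> int ing fr gr; rewrite integralZl//; last exact: integrableD.
rewrite integralD// fr gr -EFinD -EFinM; congr EFin => /=; ring.
Qed.

Section truncated_energy.
Context {R : realType} {n : nat}.
Variables (Om : set 'rV[R]_n) (T M : R) (V : R -> 'rV[R]_n -> R).
Variable tau : 'rV[R]_n -> R -> R.
Hypothesis lf : leaf_field Om T M V tau.
Variables (p e : R).
Hypothesis p_itv : n%:R < p < n%:R + 2.
Hypothesis e_gt0 : 0 < e.
Local Notation lambda := (@lebesgue_measure R).
Local Notation mu := (lebesgue_rV n).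
Local Notation u := (V 0).
Local Notation w := (V T).
Hypothesis tail_u : (\int[mu]_y (`|u y| / (1 + enorm y `^ p))%:E < +oo)%E.
Implicit Types (x y : 'rV[R]_n) (l : R).

Let T0 : 0 <= (0 : R) <= T. Proof. by rewrite lexx (lf_T_ge0 lf). Qed.
Let TT : 0 <= T <= T. Proof. by rewrite lexx (lf_T_ge0 lf). Qed.
Let p_gt0 : 0 < p.
Proof. by move: p_itv => /andP[+ _]; apply: le_lt_trans. Qed.
Let mu_ : measurable_fun setT u := lf_measurable lf T0.
Let mw_ : measurable_fun setT w := lf_measurable lf TT.

(** The kernel cut off at distance [e] from the diagonal. *)
Definition riesz_trunc x y : R := \1_[set z | e < enorm z] (x - y) * riesz p x y.

Lemma riesz_trunc_ge0 x y : 0 <= riesz_trunc x y.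
Proof. by rewrite mulr_ge0// riesz_ge0. Qed.

Lemma riesz_trunc_sym x y : riesz_trunc x y = riesz_trunc y x.
Proof.
rewrite /riesz_trunc riesz_sym; congr (_ * _).
by rewrite !indicE; congr (nat_of_bool _)%:R; apply/idP/idP; rewrite !inE/= enormB.
Qed.

Lemma measurable_riesz_trunc : measurable_fun setT
  (fun q : 'rV[R]_n * 'rV[R]_n => riesz_trunc q.1 q.2).
Proof.
apply: measurable_funM; last exact: measurable_riesz2.
apply: (measurableT_comp (f := fun z : 'rV[R]_n => \1_[set z | e < enorm z] z : R)) measurable_rV_sub.
apply: measurable_indic; have := measurable_euclid_exterior (0 : 'rV[R]_n) e.
rewrite (_ : [set y | _] = [set z | e < enorm z])//.
by apply/funext => z /=; rewrite sub0r enormN.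
Qed.

(** All the leaves are dominated by one function with integrable tail. *)
Lemma leaf_bound t y : 0 <= t <= T -> `|V t y| <= `|M * \1_Om y + `|u y| |.
Proof.
move=> tT; have M0 := lf_M_ge0 lf.
rewrite [leRHS]ger0_norm ?addr_ge0 ?mulr_ge0//.
have [Oy|Oy] := pselect (Om y); last first.
  by rewrite (lf_exterior lf tT Oy) indicE memNset// mulr0 add0r.
rewrite indicE mem_set// mulr1.
have /andP[t0 t1] := tT; have [b0 bT] := lf_bounded lf Oy.
have h1 : u y <= V t y by apply: (lf_nondecreasing lf).
have h2 : V t y <= w y by apply: (lf_nondecreasing lf).
apply: (@le_trans _ _ M); last by rewrite lerDl.
move: b0 bT; rewrite !ler_norml => /andP[? ?] /andP[? ?].
by apply/andP; split; lra.
Qed.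

Lemma leaf_set_measure_lty : (mu Om < +oo)%E.
Proof.
apply: (@le_lt_trans _ _ (mu [set y | (enorm (0 - y) <= n%:R * M)%R])).
  apply: le_measure; rewrite ?inE; [exact: lf_measurable_set lf|exact: measurable_euclid_ball|].
  move=> y Oy; rewrite /= sub0r enormN; apply: le_trans (enorm_le_norm y) _.
  by rewrite ler_wpM2l// (lf_set_bounded lf).
apply: le_lt_trans (euclid_ball_measure_le _ _) _; last by rewrite ltry.
by rewrite mulr_ge0// (lf_M_ge0 lf).
Qed.

Let den_ge1 y : 1 <= 1 + enorm y `^ p.
Proof. by rewrite lerDl powR_ge0. Qed.

Let tail_bound :
  (\int[mu]_y (`|M * \1_Om y + `|u y| | / (1 + enorm y `^ p))%:E < +oo)%E.
Proof.
have M0 := lf_M_ge0 lf.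
have mden : measurable_fun setT (fun y : 'rV[R]_n => (1 + enorm y `^ p)^-1).
  rewrite (_ : (fun y => _) = (fun y => (1 + enorm y `^ p) `^ (-1))); last first.
    by apply/funext => y; rewrite powR_inv1// (le_trans _ (den_ge1 y)).
  apply: (measurableT_comp (f := fun z : R => z `^ (-1))); first exact: measurable_powR.
  apply: measurable_funD => //.
  apply: (measurableT_comp (f := fun z : R => z `^ p)) measurable_enorm.
  exact: measurable_powR.
have den0 y : 0 <= (1 + enorm y `^ p)^-1 by rewrite invr_ge0 (le_trans _ (den_ge1 y)).
apply: (@le_lt_trans _ _ (\int[mu]_y ((M * \1_Om y)%:E + (`|u y| / (1 + enorm y `^ p))%:E))%E).
  apply: le_integral_pointwise => y _; rewrite -EFinD lee_fin.
  rewrite ger0_norm ?addr_ge0 ?mulr_ge0// mulrDl lerD2r.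
  by rewrite ler_piMr ?mulr_ge0// invf_le1 ?(lt_le_trans _ (den_ge1 y)).
rewrite ge0_integralD//; last 4 first.
- by move=> y _; rewrite lee_fin mulr_ge0.
- apply/measurable_EFinP; apply: measurable_funM => //; apply: measurable_indic.
  exact: lf_measurable_set lf.
- by move=> y _; rewrite lee_fin mulr_ge0.
- apply/measurable_EFinP; apply: measurable_funM => //.
  exact: measurableT_comp.
apply: lte_add_pinfty => //.
under eq_integral do rewrite EFinM.
rewrite ge0_integralZl_EFin//; last first.
- by apply/measurable_EFinP; apply: measurable_indic; exact: lf_measurable_set lf.
rewrite integral_indic//; last exact: lf_measurable_set lf.
by rewrite setIT lte_mul_pinfty// leaf_set_measure_lty.
Qed.

(** Integrability of the truncated kernel against the differences of all
leaves, uniformly in the base point. *)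
Lemma leaf_pv_dominated : exists2 C, 0 <= C & forall x t, Om x -> 0 <= t <= T ->
  mu.-integrable [set y | e < enorm (x - y)]
    (EFin \o (fun y => (V t x - V t y) * riesz p x y)) /\
  (\int[mu]_(y in [set y | (e < enorm (x - y))%R])
    `|((V t x - V t y) * riesz p x y)%:E| <= C%:E)%E.
Proof.
have M0 := lf_M_ge0 lf.
have mG : measurable_fun setT (fun y => M * \1_Om y + `|u y|).
  apply: measurable_funD; last exact: measurableT_comp.
  by apply: measurable_funM => //; apply: measurable_indic; exact: lf_measurable_set lf.
have [C C0 H] := pv_dominated p_itv M0 M0 e_gt0 mG tail_bound.
exists C => // x t Ox tT; apply: H.
- exact: lf_set_bounded lf _ Ox.
- exact: lf_measurable lf _ tT.
- have [b0 bT] := lf_bounded lf Ox; have /andP[t0 t1] := tT.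
  have h1 : u x <= V t x by apply: (lf_nondecreasing lf).
  have h2 : V t x <= w x by apply: (lf_nondecreasing lf).
  move: b0 bT; rewrite !ler_norml => /andP[? ?] /andP[? ?].
  by apply/andP; split; lra.
- by move=> y; exact: leaf_bound.
Qed.


Local Notation sweptV := (swept Om T V).
Local Notation incr := (leaf_incr Om T V tau).
Local Notation area := (leaf_area Om T V tau).

(** The integrand of the truncated operator applied to the leaf through
[(x, l)], extended by [0] to the values [l] that are not swept. *)
Definition leaf_kernel x l y : R :=
  (\1_sweptV (x, l) * (l - u y) - incr x y l) * riesz_trunc x y.

(** The truncated operator at [x], applied to the leaf through [(x, l)]. *)
Definition leaf_trunc x (l : R) : \bar R := pv_trunc p (V (tau x l)) x e.

(** Twice the integral of [l - V (tau x l) y] over the values [l] swept at [x]; it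
vanishes when [x] is outside [Om]. *)
Definition leaf_density x y : R :=
  (w x - u x) * (w x + u x - 2 * u y) - 2 * fine (area x y).

Let leaf_kernelE x l y : sweptV (x, l) ->
  leaf_kernel x l y = (l - V (tau x l) y) * riesz_trunc x y.
Proof.
move=> sw; rewrite /leaf_kernel indicE mem_set// mul1r /leaf_incr asboolT//.
by congr (_ * _); ring.
Qed.

Let leaf_kernel0 x l y : ~ sweptV (x, l) -> leaf_kernel x l y = 0.
Proof.
move=> sw; rewrite /leaf_kernel indicE memNset// mul0r /leaf_incr asboolF//.
by rewrite subr0 mul0r.
Qed.

Lemma measurable_leaf_kernel x : measurable_fun setT
  (fun z : measurableTypeR R * 'rV[R]_n => leaf_kernel x z.1 z.2).
Proof.
apply: measurable_funM; last first.
  apply: (measurableT_comp (f := fun y => riesz_trunc x y)); last exact: measurable_snd.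
  exact: (measurableT_comp measurable_riesz_trunc (measurable_pair1 x)).
apply: measurable_funB; last first.
  apply: (measurableT_comp (measurable_leaf_incr lf)
    (g := fun z : measurableTypeR R * 'rV[R]_n => ((x, z.2), z.1))).
  by apply: measurable_fun_pair => //; apply: measurable_fun_pair.
apply: measurable_funM; last first.
  apply: measurable_funB; first exact: measurable_fst.
  by apply: measurableT_comp => //; exact: measurable_snd.
apply: (measurableT_comp (f := fun z : 'rV[R]_n * measurableTypeR R => \1_sweptV z : R)
    (g := fun z : measurableTypeR R * 'rV[R]_n => (x, z.1))).
  by apply: measurable_indic; exact: measurable_swept lf.
by apply: measurable_fun_pair.
Qed.

Let exteriorE x (f : 'rV[R]_n -> R) :
  (\int[mu]_(y in [set y | (e < enorm (x - y))%R]) (f y * riesz p x y)%:E =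
   \int[mu]_y (f y * riesz_trunc x y)%:E)%E.
Proof.
rewrite integral_mkcond; apply: eq_integral => y _.
rewrite patchE /riesz_trunc indicE; case: ifPn => [/set_mem xy|xy].
  by rewrite mem_set// mul1r.
rewrite memNset ?mul0r ?mulr0// => xy'; move: xy.
by rewrite mem_set.
Qed.

Lemma integral_leaf_kernel x l : sweptV (x, l) ->
  (\int[mu]_y (leaf_kernel x l y)%:E = leaf_trunc x l)%E.
Proof.
move=> sw; rewrite /leaf_trunc /pv_trunc; have [/= Ox xl] := sw.
have [_ Vx] := lf_leaf lf Ox xl.
rewrite (exteriorE x (fun y => V (tau x l) x - V (tau x l) y)).
by apply: eq_integral => y _; rewrite leaf_kernelE// Vx.
Qed.

Lemma leaf_trunc_fin_num x l : sweptV (x, l) -> leaf_trunc x l \is a fin_num.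
Proof.
move=> sw; have [C _ /(_ x (tau x l))[|//|int _]] := leaf_pv_dominated.
- by case: sw.
- exact: (leaf_time_itv lf sw).
- by apply: integrable_fin_num int; exact: measurable_euclid_exterior.
Qed.

Let sweptE x : Om x -> [set l | sweptV (x, l)] = `]u x, w x[%classic.
Proof.
by move=> Ox; apply/seteqP; split => l /=; rewrite in_itv/=; [case|].
Qed.

Let itvlen (a b : R) : a <= b -> lambda `]a, b[%classic = (b - a)%:E.
Proof.
move=> ab; rewrite lebesgue_measure_itv/= lte_fin; case: ltP => // ba.
by rewrite (_ : b = a) ?subrr//; apply/eqP; rewrite eq_le ab ba.
Qed.

Lemma leaf_kernel_dominated : exists2 C, 0 <= C & forall x, Om x ->
  (\int[lambda]_l \int[mu]_y `|(leaf_kernel x l y)%:E| <= C%:E)%E.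
Proof.
have [C C0 H] := leaf_pv_dominated; have M0 := lf_M_ge0 lf.
exists (C * (2 * M)) => [|x Ox]; first by rewrite !mulr_ge0.
apply: (@le_trans _ _ (\int[lambda]_(l in `]u x, w x[%classic) C%:E)%E).
  rewrite [leRHS]integral_mkcond; apply: le_integral_pointwise => l _.
  rewrite patchE; case: ifPn => [|/negP].
    rewrite -sweptE// => /set_mem sw.
    have [_ HC] := H x _ Ox (leaf_time_itv lf sw); apply: le_trans HC.
    have [/= _ xl] := sw; have [_ Vx] := lf_leaf lf Ox xl.
    rewrite le_eqVlt; apply/orP; left; apply/eqP.
    transitivity (\int[mu]_(y in [set y | (e < enorm (x - y))%R])
        (`|V (tau x l) x - V (tau x l) y| * riesz p x y)%:E)%E; last first.
      apply: eq_integral => y _.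
      by rewrite -[RHS]/(`|_|%R)%:E normrM (ger0_norm (riesz_ge0 _ _ _)).
    rewrite (exteriorE x (fun y => `|V (tau x l) x - V (tau x l) y|)).
    apply: eq_integral => y _.
    by rewrite leaf_kernelE// -[LHS]/(`|_|%R)%:E normrM (ger0_norm (riesz_trunc_ge0 _ _)) Vx.
  rewrite -sweptE// => sw; rewrite integral0_eq// => y _.
  by rewrite leaf_kernel0 ?abse0// => sw'; apply: sw; rewrite mem_set.
rewrite integral_cst//= EFinM; apply: lee_wpmul2l; first by rewrite lee_fin.
rewrite [X in (X <= _)%E](itvlen (lf_uw lf x)) lee_fin.
have [] := lf_bounded lf Ox; rewrite !ler_norml => /andP[? ?] /andP[? ?].
by lra.
Qed.

Lemma leaf_kernel_integrable x : Om x -> (lambda \x mu)%E.-integrable setT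
  (fun z => (leaf_kernel x z.1 z.2)%:E).
Proof.
move=> Ox; apply/integrable12ltyP => /=.
  by apply/measurable_EFinP; exact: measurable_leaf_kernel.
have [C _ /(_ x Ox)] := leaf_kernel_dominated.
by move=> /le_lt_trans; apply; rewrite ltry.
Qed.

Let leaf_kernel_integral_fin_num x : Om x ->
  (\int[mu]_y \int[lambda]_l (leaf_kernel x l y)%:E)%E \is a fin_num.
Proof.
move=> Ox; have int := leaf_kernel_integrable Ox.
by rewrite [X in X \is a _](integral21_prod_meas1 int); exact: integrable_fin_num int.
Qed.

Lemma leaf_area_fin_num x y : area x y \is a fin_num.
Proof.
have yo := leaf_area_young lf x y; have h := leaf_area_ge0 lf x y.
have h' := leaf_area_ge0 lf y x; rewrite ge0_fin_numE//.
by apply: (@le_lt_trans _ _ (area x y + area y x)%E); [rewrite leeDl|rewrite yo ltry].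
Qed.

Let swept_affine x c : Om x ->
  lambda.-integrable setT (fun l => (\1_sweptV (x, l) * (l - c))%:E) /\
  (\int[lambda]_l (\1_sweptV (x, l) * (l - c))%:E =
    ((w x - u x) * (w x + u x - 2 * c) / 2)%:E)%E.
Proof.
move=> Ox; have [int <-] := integral_affine_oo c (lf_uw lf x).
have E : (fun l => (\1_sweptV (x, l) * (l - c))%:E) =
    (fun l => (l - c)%:E) \_ (`]u x, w x[%classic).
  apply/funext => l; rewrite patchE indicE -sweptE//.
  case: ifPn => [/set_mem sw|sw]; first by rewrite mem_set// mul1r.
  by rewrite memNset ?mul0r// => sw'; move: sw; rewrite mem_set.
rewrite E; split; last by rewrite [RHS]integral_mkcond.
by apply/(integrable_mkcond _ _).1 => //; exact: int.
Qed.

(** Integrating the kernel in [l] gives half the density times the truncated Riesz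
kernel; integrating it in [y] gives the truncated operator ([integral_leaf_kernel]). *)
Lemma integral_leaf_kernel_level x y : Om x ->
  (\int[lambda]_l (leaf_kernel x l y)%:E =
   (leaf_density x y / 2 * riesz_trunc x y)%:E)%E.
Proof.
move=> Ox; have [int val] := swept_affine (u y) Ox.
have inc : lambda.-integrable setT (EFin \o (incr x y)).
  apply/integrableP; split.
    by apply/measurable_EFinP; exact: measurable_leaf_incr_r lf x y.
  rewrite (eq_integral (fun l : measurableTypeR R => (incr x y l)%:E)).
    by rewrite -ge0_fin_numE ?leaf_area_fin_num//; exact: leaf_area_ge0 lf x y.
  by move=> l _; rewrite /= ger0_norm// (leaf_incr_ge0 lf).
rewrite /leaf_kernel.
rewrite (eq_integral (fun l : measurableTypeR R => ((riesz_trunc x y)%:E *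
    ((\1_sweptV (x, l) * (l - u y))%:E - (incr x y l)%:E))%E)); last first.
  by move=> l _; rewrite -EFinB -EFinM mulrC.
rewrite integralZl//; last exact: integrableB.
rewrite integralB_EFin// val -/(area x y) -(fineK (leaf_area_fin_num x y)).
by rewrite -EFinB -EFinM /leaf_density; congr EFin; field.
Qed.

(** The integral of the truncated operator over the values swept at [x]; see
[leaf_energyE]. *)
Definition leaf_energy x : R :=
  fine (\int[mu]_y (leaf_density x y / 2 * riesz_trunc x y)%:E)%E.

Lemma leaf_density_exterior x y : ~ Om x -> leaf_density x y = 0.
Proof.
move=> Ox; rewrite /leaf_density (leaf_area0 lf (or_introl Ox)).
by rewrite (lf_exterior lf TT Ox) subrr mul0r mulr0 subr0.
Qed.

Lemma measurable_leaf_density : measurable_fun setT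
  (fun q : 'rV[R]_n * 'rV[R]_n => leaf_density q.1 q.2).
Proof.
have m1 f : measurable_fun setT f ->
    measurable_fun setT (fun q : 'rV[R]_n * 'rV[R]_n => f q.1 : R).
  by move=> mf; apply: (measurableT_comp mf); exact: measurable_fst.
have m2 f : measurable_fun setT f ->
    measurable_fun setT (fun q : 'rV[R]_n * 'rV[R]_n => f q.2 : R).
  by move=> mf; apply: (measurableT_comp mf); exact: measurable_snd.
apply: measurable_funB.
  apply: measurable_funM; first by apply: measurable_funB; exact: m1.
  apply: measurable_funB; first by apply: measurable_funD; exact: m1.
  by apply: measurable_funM => //; exact: m2.
apply: measurable_funM => //.
exact: (measurableT_comp (fine_measurable measurableT) (measurable_leaf_area lf)).
Qed.

Let measurable_density_kernel : measurable_fun setT (fun q : 'rV[R]_n * 'rV[R]_n =>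
  (leaf_density q.1 q.2 / 2 * riesz_trunc q.1 q.2)%:E).
Proof.
apply/measurable_EFinP; apply: measurable_funM; last exact: measurable_riesz_trunc.
by apply: measurable_funM => //; exact: measurable_leaf_density.
Qed.

Lemma leaf_density_integrable : (mu \x mu)%E.-integrable setT
  (fun q => (leaf_density q.1 q.2 / 2 * riesz_trunc q.1 q.2)%:E).
Proof.
apply/integrable12ltyP => //=.
have [C C0 H] := leaf_kernel_dominated.
apply: (@le_lt_trans _ _ (\int[mu]_(x in Om) C%:E)%E); last first.
  rewrite integral_cst ?lte_mul_pinfty ?leaf_set_measure_lty//.
  exact: lf_measurable_set lf.
rewrite [leRHS]integral_mkcond; apply: le_integral_pointwise => x _.
rewrite patchE; case: ifPn => [/set_mem Ox|/negP Ox]; last first.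
  rewrite integral0_eq// => y _; rewrite leaf_density_exterior; last by move=> /mem_set.
  by rewrite !mul0r /= normr0.
apply: le_trans (H x Ox).
have -> : (\int[lambda]_l \int[mu]_y `|(leaf_kernel x l y)%:E| =
    \int[mu]_y \int[lambda]_l `|(leaf_kernel x l y)%:E|)%E.
  rewrite -[LHS]/(\int[lambda]_l \int[mu]_y ((abse \o (fun z : measurableTypeR R * 'rV[R]_n =>
    (leaf_kernel x z.1 z.2)%:E)) (l, y)))%E fubini_tonelli//; last by move=> z; exact: abse_ge0.
  by apply: measurableT_comp => //; apply/measurable_EFinP; exact: measurable_leaf_kernel.
apply: le_integral_pointwise => y _.
rewrite -[leLHS]/(`|(leaf_density x y / 2 * riesz_trunc x y)%:E|)%E.
rewrite -integral_leaf_kernel_level//.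
apply: le_abse_integral => //; apply/measurable_EFinP.
exact: (measurableT_comp (measurable_leaf_kernel x) (measurable_pair2 y)).
Qed.

Lemma leaf_energy_exterior x : ~ Om x -> leaf_energy x = 0.
Proof.
move=> Ox; rewrite /leaf_energy integral0_eq// => y _.
by rewrite leaf_density_exterior// !mul0r.
Qed.

Lemma leaf_energyE x : Om x ->
  lambda.-integrable `]u x, w x[%classic (leaf_trunc x) /\
  (\int[lambda]_(l in `]u x, w x[%classic) leaf_trunc x l = (leaf_energy x)%:E)%E.
Proof.
move=> Ox; have int := leaf_kernel_integrable Ox.
have E : (fun l => \int[mu]_y (leaf_kernel x l y)%:E)%E =
    (leaf_trunc x) \_ (`]u x, w x[%classic).
  apply/funext => l; rewrite patchE -sweptE//; case: ifPn => [/set_mem sw|sw].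
    by rewrite integral_leaf_kernel.
  rewrite integral0_eq// => y _; rewrite leaf_kernel0// => sw'.
  by move: sw; rewrite mem_set.
have intF := integrable_fubini_F int.
have Gval : (\int[mu]_y \int[lambda]_l (leaf_kernel x l y)%:E = (leaf_energy x)%:E)%E.
  have fin : (\int[mu]_y \int[lambda]_l (leaf_kernel x l y)%:E \is a fin_num)%E.
    exact: leaf_kernel_integral_fin_num.
  rewrite -(fineK fin); congr (fine _)%:E; apply: eq_integral => y _.
  exact: integral_leaf_kernel_level.
split.
  by apply/(integrable_mkcond _ _).2 => //; rewrite -E; exact: intF.
rewrite integral_mkcond -E -Gval.
exact: (Fubini int).
Qed.

Lemma leaf_energy_integrable : mu.-integrable setT (EFin \o leaf_energy).
Proof.
have intF := integrable_fubini_F leaf_density_integrable.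
apply: eq_integrable intF => // x _ /=; rewrite /leaf_energy fineK//.
have [Ox|Ox] := pselect (Om x); last first.
  by rewrite integral0_eq// => y _; rewrite leaf_density_exterior ?mul0r.
rewrite (eq_integral (fun y => \int[lambda]_l (leaf_kernel x l y)%:E)%E).
  exact: leaf_kernel_integral_fin_num.
by move=> y _; rewrite integral_leaf_kernel_level.
Qed.

(** The square differences of the last and first leaves differ by the
symmetrization of [leaf_density]. *)
Lemma sqr_diff_leaf_density x y :
  (w x - w y) ^+ 2 - (u x - u y) ^+ 2 = leaf_density x y + leaf_density y x.
Proof.
have := leaf_area_young lf x y.
rewrite -(fineK (leaf_area_fin_num x y)) -(fineK (leaf_area_fin_num y x)) -EFinD.
by case=> yo; rewrite /leaf_density; lra.
Qed.

(** The energy with the kernel cut off, without the factor [c / 4]. *)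
Definition energy_trunc (v : 'rV[R]_n -> R) : \bar R :=
  (\int[mu \x mu]_(q in Qset Om) (`|v q.1 - v q.2| ^+ 2 * riesz_trunc q.1 q.2)%:E)%E.

Lemma measurable_Qset : measurable (Qset Om).
Proof.
apply: measurableC; apply: measurableX; apply: measurableC; exact: lf_measurable_set lf.
Qed.

Lemma measurable_energy_integrand (v : 'rV[R]_n -> R) : measurable_fun setT v -> measurable_fun setT
  (fun q : 'rV[R]_n * 'rV[R]_n => `|v q.1 - v q.2| ^+ 2 * riesz_trunc q.1 q.2).
Proof.
move=> mv; apply: measurable_funM; last exact: measurable_riesz_trunc.
apply: measurable_funX; apply: measurableT_comp => //.
by apply: measurable_funB; apply: (measurableT_comp mv).
Qed.

(** The truncated energy varies, from the first leaf to the last one, by the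
integral of the truncated operator along the leaves. *)
Lemma energy_trunc_variation : (energy_trunc u < +oo)%E ->
  (energy_trunc w = energy_trunc u + (4 * fine (\int[mu]_x (leaf_energy x)%:E))%:E)%E.
Proof.
move=> Eu; have mQ := measurable_Qset.
have ge0 (v : 'rV[R]_n -> R) (q : 'rV[R]_n * 'rV[R]_n) : 0 <= `|v q.1 - v q.2| ^+ 2 * riesz_trunc q.1 q.2.
  by rewrite mulr_ge0 ?sqr_ge0 ?riesz_trunc_ge0.
have iu : (mu \x mu)%E.-integrable (Qset Om)
    (fun q => (`|u q.1 - u q.2| ^+ 2 * riesz_trunc q.1 q.2)%:E).
  apply/integrableP; split.
    apply/measurable_EFinP/(measurable_funS measurableT) => //.
    exact: measurable_energy_integrand.
  rewrite (eq_integral (fun q => (`|u q.1 - u q.2| ^+ 2 * riesz_trunc q.1 q.2)%:E))//.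
  by move=> q _; rewrite gee0_abs// lee_fin ge0.
pose g (q : 'rV[R]_n * 'rV[R]_n) := (leaf_density q.1 q.2 / 2 * riesz_trunc q.1 q.2)%:E.
pose g' (q : 'rV[R]_n * 'rV[R]_n) := (leaf_density q.2 q.1 / 2 * riesz_trunc q.2 q.1)%:E.
have ig : (mu \x mu)%E.-integrable setT g := leaf_density_integrable.
have mg' : measurable_fun setT g'.
  apply: (measurableT_comp measurable_density_kernel
    (g := fun q : 'rV[R]_n * 'rV[R]_n => (q.2, q.1))).
  by apply: measurable_fun_pair.
have ig' : (mu \x mu)%E.-integrable setT g'.
  apply/integrable21ltyP => //=.
  by have /integrable12ltyP := ig; apply; exact: measurable_density_kernel.
have gI : (\int[mu \x mu]_q g q = \int[mu]_x (leaf_energy x)%:E)%E.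
  rewrite -(integral12_prod_meas1 ig); apply: eq_integral => x _.
  have /integrable_fin_num := integrable_fubini_F ig.
  rewrite /leaf_energy /fubini_F /g fineK//.
  have [Ox|Ox] := pselect (Om x); last first.
    by rewrite integral0_eq// => y _; rewrite leaf_density_exterior ?mul0r.
  rewrite (eq_integral (fun y => \int[lambda]_l (leaf_kernel x l y)%:E)%E).
    exact: leaf_kernel_integral_fin_num.
  by move=> y _; rewrite integral_leaf_kernel_level.
have g'I : (\int[mu \x mu]_q g' q = \int[mu \x mu]_q g q)%E.
  apply: eq_trans (esym (integral21_prod_meas1 ig')) _.
  apply: eq_trans (integral12_prod_meas1 ig).
  by apply: eq_integral => x _; apply: eq_integral.
have gfin : (\int[mu \x mu]_q g q)%E \is a fin_num by exact: integrable_fin_num ig.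
(* The symmetrized density times the kernel; it vanishes outside [Qset Om]. *)
pose J q := (2%:E * (g q + g' q))%E.
have iJ : (mu \x mu)%E.-integrable setT J.
  exact: (integrableZl measurableT 2 (integrableD measurableT ig ig')).
have JE q : J q = (((w q.1 - w q.2) ^+ 2 - (u q.1 - u q.2) ^+ 2) * riesz_trunc q.1 q.2)%:E.
  rewrite sqr_diff_leaf_density /J /g /g' (riesz_trunc_sym q.2) -EFinD -EFinM.
  by congr EFin; field.
have JQ : (\int[mu \x mu]_(q in Qset Om) J q = \int[mu \x mu]_q J q)%E.
  rewrite integral_mkcond; apply: eq_integral => q _.
  rewrite patchE; case: ifPn => [_|/negP qQ]; first by reflexivity.
  have [nOx nOy] : ~ Om q.1 /\ ~ Om q.2.
    by split => Oq; apply: qQ; apply: mem_set => -[nO1 nO2]; [exact: nO1|exact: nO2].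
  rewrite JE (lf_exterior lf TT nOx) (lf_exterior lf TT nOy) subrr mul0r.
  by reflexivity.
have JI : (\int[mu \x mu]_q J q = (4 * fine (\int[mu]_x (leaf_energy x)%:E))%:E)%E.
  have gr : (\int[mu \x mu]_q g q = (fine (\int[mu]_x (leaf_energy x)%:E))%:E)%E.
    by apply: eq_trans (esym (fineK gfin)) _; rewrite gI.
  exact: (integral_twice_sum ig ig' gr (eq_trans g'I gr)).
move: J iJ JE JQ JI => {g g' ig mg' ig' gI g'I gfin} J iJ JE JQ JI.
rewrite /energy_trunc -JI -JQ -(integralD mQ iu); last first.
  exact: integrableS iJ.
apply: eq_integral => q _.
by rewrite JE -EFinD !real_normK ?num_real//; congr EFin; ring.
Qed.

End truncated_energy.


(** * The calibration inequality *)

Lemma le_limn_esup (R : realType) (a : \bar R) (v : (\bar R)^nat) (k0 : nat) :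
  (forall k, (k0 <= k)%N -> (a <= v k)%E) -> (a <= limn_esup v)%E.
Proof.
move=> av; rewrite limn_esup_lim; apply: lime_ge; first exact: is_cvg_esups.
near=> m; apply: (@le_trans _ _ (v (maxn k0 m))); first by apply: av; rewrite leq_maxl.
by apply: ereal_sup_ubound; exists (maxn k0 m) => //=; rewrite leq_maxr.
Unshelve. all: by end_near. Qed.

Lemma riesz_trunc_le (R : realType) n (p e e' : R) (x y : 'rV[R]_n) : e' <= e ->
  riesz_trunc p e x y <= riesz_trunc p e' x y.
Proof.
move=> ee; rewrite ler_wpM2r ?riesz_ge0// !indicE.
case: (boolP (_ \in [set z | e < _])) => // /set_mem /= iq.
by rewrite mem_set//=; exact: le_lt_trans iq.
Qed.

Section energy_inequality.
Context {R : realType} {n : nat}.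
Variables (Om : set 'rV[R]_n) (T M : R) (V : R -> 'rV[R]_n -> R).
Variable tau : 'rV[R]_n -> R -> R.
Hypothesis lf : leaf_field Om T M V tau.
Variable p : R.
Hypothesis p_itv : n%:R < p < n%:R + 2.
Local Notation lambda := (@lebesgue_measure R).
Local Notation mu := (lebesgue_rV n).
Local Notation u := (V 0).
Local Notation w := (V T).
Hypothesis tail_u : (\int[mu]_y (`|u y| / (1 + enorm y `^ p))%:E < +oo)%E.
Implicit Types (x y : 'rV[R]_n) (l : R).

Let TT : 0 <= T <= T. Proof. by rewrite lexx (lf_T_ge0 lf). Qed.
Let T0 : 0 <= (0 : R) <= T. Proof. by rewrite lexx (lf_T_ge0 lf). Qed.

(** The energy without the factor [c / 4]. *)
Definition energy_full (v : 'rV[R]_n -> R) : \bar R :=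
  (\int[mu \x mu]_(q in Qset Om) (`|v q.1 - v q.2| ^+ 2 * riesz p q.1 q.2)%:E)%E.

Let energy_term_ge0 (v : 'rV[R]_n -> R) (q : 'rV[R]_n * 'rV[R]_n) :
  0 <= `|v q.1 - v q.2| ^+ 2 * riesz p q.1 q.2.
Proof. by rewrite mulr_ge0 ?sqr_ge0 ?riesz_ge0. Qed.

Lemma energy_trunc_le (e : R) v : (energy_trunc Om p e v <= energy_full v)%E.
Proof.
apply: le_integral_pointwise => q _; rewrite lee_fin ler_wpM2l ?sqr_ge0//.
by rewrite /riesz_trunc indicE ler_piMl ?riesz_ge0//; case: (_ \in _).
Qed.

Lemma energy_trunc_cvg (r : R) (v : 'rV[R]_n -> R) : 0 < r -> measurable_fun setT v ->
  energy_trunc Om p (r / k.+1%:R) v @[k --> \oo] --> energy_full v.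
Proof.
move=> r0 mv.
pose G (k : nat) (q : 'rV[R]_n * 'rV[R]_n) :=
  (`|v q.1 - v q.2| ^+ 2 * riesz_trunc p (r / k.+1%:R) q.1 q.2)%:E.
have Glim q : G ^~ q @ \oo --> (`|v q.1 - v q.2| ^+ 2 * riesz p q.1 q.2)%:E.
  have [d0|d0] := eqVneq (enorm (q.1 - q.2)) 0.
    have qq : q.1 = q.2 by apply/subr0_eq/enorm_eq0.
    have -> : G ^~ q = cst 0%E.
      by apply/funext => k; rewrite /G qq subrr normr0 expr0n mul0r.
    by rewrite qq subrr normr0 expr0n mul0r; exact: cvg_cst.
  have d1 : 0 < enorm (q.1 - q.2) by rewrite lt_def d0 enorm_ge0.
  apply: cvg_near_cst; near=> k.
  rewrite /G /riesz_trunc indicE mem_set ?mul1r//=.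
  rewrite ltr_pdivrMr// mulrC -ltr_pdivrMr//.
  apply: lt_le_trans (archi_boundP _) _; first by rewrite divr_ge0// ltW.
  rewrite ler_nat; apply: leqW; near: k.
  by exists (Num.bound (r / enorm (q.1 - q.2))).
have -> : energy_full v = (\int[mu \x mu]_(q in Qset Om) limn (G ^~ q))%E.
  by apply: eq_integral => q _; apply/esym/cvg_lim => //; exact: Glim.
apply: cvg_monotone_convergence.
- exact: measurable_Qset lf.
- move=> k; apply/measurable_EFinP/(measurable_funS measurableT) => //.
  exact: measurable_energy_integrand.
- by move=> k q _; rewrite lee_fin mulr_ge0 ?sqr_ge0 ?riesz_trunc_ge0.
- move=> q _ i j ij; rewrite lee_fin ler_wpM2l ?sqr_ge0//; apply: riesz_trunc_le.
  by rewrite ler_pM2l// lef_pV2 ?posrE// ler_nat.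
Unshelve. all: by end_near. Qed.

Variables (r B : R).
Hypothesis r_gt0 : 0 < r.
Hypothesis pv_cvg : forall x l, swept Om T V (x, l) ->
  cvg (pv_trunc p (V (tau x l)) x e @[e --> (0 : R)^'+]).
Hypothesis pv_le : forall x l e, swept Om T V (x, l) -> 0 < e <= r ->
  (pv_trunc p (V (tau x l)) x e <= B%:E)%E.

Variables (c : R) (F : R -> R).
Hypothesis c_gt0 : 0 < c.
Hypothesis F_der : forall z, derivable F z 1.
Hypothesis F_C1 : continuous (derive1 F).

(* Radii decreasing to [0]. *)
Let e_ (k : nat) : R := r / k.+1%:R.

Let e_itv k : 0 < e_ k <= r.
Proof.
by rewrite divr_gt0//= ler_pdivrMr// ler_peMr ?(ltW r_gt0)// ler1n.
Qed.

Let e_gt0 k : 0 < e_ k. Proof. by case/andP: (e_itv k). Qed.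

Let e_cvg : e_ k @[k --> \oo] --> (0 : R)^'+.
Proof.
move=> A [d /= d0 dA]; exists (Num.bound (r / d)) => // k /= dk.
apply: dA => /=; last exact: e_gt0.
rewrite sub0r normrN gtr0_norm// /e_ ltr_pdivrMr// mulrC -ltr_pdivrMr//.
apply: lt_le_trans (archi_boundP _) _; first by rewrite divr_ge0// ltW.
by rewrite ler_nat leqW.
Qed.

Let F' := derive1 F.
(* The integrands whose upper limits [G] dominates, and their integrals [hk] over
   the values swept at [x]. *)
Let Lk k x l : R := c * fine (leaf_trunc V tau p (e_ k) x l) - F' l.

Let sweptE x l : Om x -> `]u x, w x[%classic l -> swept Om T V (x, l).
Proof. by move=> Ox; rewrite /= in_itv. Qed.

Let F'_int x : lambda.-integrable `]u x, w x[%classic (EFin \o F').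
Proof. exact: (integral_derive1_oo (lf_uw lf x) F_der F_C1).1. Qed.

Let cB_int x (b : R) : lambda.-integrable `]u x, w x[%classic (EFin \o cst b).
Proof.
have int : lambda.-integrable `[u x, w x] (EFin \o (cst b : R -> R)).
  apply: continuous_compact_integrable; first exact: segment_compact.
  by apply: continuous_subspaceT => z; exact: cvg_cst.
by apply: integrableS int => //; exact: subset_itv_oo_cc.
Qed.

Let itvT := measurableTypeR R.
Let mI x : measurable (`]u x, w x[%classic : set itvT).
Proof. exact: measurable_itv. Qed.

Let trunc_fine k x : Om x ->
  {in `]u x, w x[%classic, leaf_trunc V tau p (e_ k) x =1
     EFin \o (fun l => fine (leaf_trunc V tau p (e_ k) x l))}.
Proof.
move=> Ox l /set_mem/(sweptE Ox) sw.
by rewrite /= fineK// (leaf_trunc_fin_num lf p_itv (e_gt0 k) tail_u sw).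
Qed.

Let trunc_int k x : Om x -> lambda.-integrable `]u x, w x[%classic
  (EFin \o (fun l => fine (leaf_trunc V tau p (e_ k) x l))).
Proof.
move=> Ox; have [int _] := leaf_energyE lf p_itv (e_gt0 k) tail_u Ox.
by apply: eq_integrable int => //; exact: trunc_fine.
Qed.

Let Lk_int k x : Om x -> lambda.-integrable `]u x, w x[%classic (EFin \o Lk k x).
Proof.
move=> Ox; have intf := trunc_int k Ox.
have -> : EFin \o Lk k x = ((fun l => c%:E * (EFin \o (fun l =>
    fine (leaf_trunc V tau p (e_ k) x l))) l) \- (EFin \o F'))%E.
  by apply/funext => l.
by apply: integrableB => //; exact: integrableZl.
Qed.

Let hk k x : R := c * leaf_energy Om T V tau p (e_ k) x - (F (w x) - F (u x)).

Let integral_Lk k x : Om x ->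
  (\int[lambda]_(l in `]u x, w x[%classic) (Lk k x l)%:E = (hk k x)%:E)%E.
Proof.
move=> Ox; have [_ val] := leaf_energyE lf p_itv (e_gt0 k) tail_u Ox.
have intf := trunc_int k Ox.
have [_ Fval] := integral_derive1_oo (lf_uw lf x) F_der F_C1.
have cint := integrableZl (mI x) c intf.
transitivity (\int[lambda]_(l in `]u x, w x[%classic)
    (((fun l => c%:E * (EFin \o (fun l =>
    fine (leaf_trunc V tau p (e_ k) x l))) l) \- (EFin \o F')) l))%E => //.
rewrite (integralB (mI x) cint (F'_int x)).
rewrite (integralZl (mI x) intf) Fval /hk [RHS]EFinB [in RHS]EFinM -val.
congr (_ * _ - _)%E.
by apply/esym/eq_integral; exact: trunc_fine.
Qed.

Variable G : 'rV[R]_n -> R -> \bar R.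
Hypothesis GE : forall x l, swept Om T V (x, l) -> G x l =
  (c%:E * lim (pv_trunc p (V (tau x l)) x e @[e --> (0 : R)^'+]) - (F' l)%:E)%E.

Let Lk_le k x l : Om x -> `]u x, w x[%classic l -> Lk k x l <= c * B - F' l.
Proof.
move=> Ox /(sweptE Ox) sw; rewrite lerD2r ler_wpM2l ?(ltW c_gt0)//.
have fin := leaf_trunc_fin_num lf p_itv (e_gt0 k) tail_u sw.
rewrite -lee_fin (fineK fin).
exact: pv_le sw (e_itv k).
Qed.

Let bound_int x : lambda.-integrable `]u x, w x[%classic (EFin \o (fun l => (c * B - F' l)%R)).
Proof.
have -> : EFin \o (fun l => (c * B - F' l)%R) = ((EFin \o cst (c * B)%R) \- (EFin \o F'))%E.
  by apply/funext.
exact: integrableB.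
Qed.

Let inner_le x : Om x ->
  (limn_esup (fun k => (hk k x)%:E) <= \int[lambda]_(l in `]u x, w x]%classic) G x l)%E.
Proof.
move=> Ox.
have -> : (\int[lambda]_(l in `]u x, w x]%classic) G x l =
    \int[lambda]_(l in `]u x, w x[%classic) G x l)%E.
  rewrite integral_mkcond [RHS]integral_mkcond; apply: ae_eq_integral_pointwise.
  exists [set w x]; split => //; first exact: lebesgue_measure_set1.
  move=> l /= /not_implyP[_ h]; apply: contrapT => lw; apply: h.
  rewrite !patchE; congr (if _ then _ else _).
  apply/idP/idP; rewrite !inE/= !in_itv/= => /andP[-> h2]/=; last exact: ltW.
  by rewrite lt_neqAle h2 andbT; exact/eqP.
have -> : (fun k => (hk k x)%:E) =
    (fun k => \int[lambda]_(l in `]u x, w x[%classic) (Lk k x l)%:E)%E.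
  by apply/funext => k; rewrite integral_Lk.
apply: (reverse_fatou (mI x) (bound_int x)).
- by move=> k; exact: Lk_int.
- by move=> k l; exact: Lk_le.
- move=> l xl; have sw := sweptE Ox xl.
  have lc : (Lk k x l)%:E @[k --> \oo] --> G x l.
    rewrite (GE sw).
    have -> : (fun k => (Lk k x l)%:E) =
        (fun k => c%:E * pv_trunc p (V (tau x l)) x (e_ k) - (F' l)%:E)%E.
      apply/funext => k; have fin := leaf_trunc_fin_num lf p_itv (e_gt0 k) tail_u sw.
      by rewrite /Lk EFinB EFinM (fineK fin).
    apply: cvgeB; [by rewrite fin_num_adde_defl| |exact: cvg_cst].
    apply: cvgeZl => //.
    exact: (cvg_comp _ _ e_cvg (pv_cvg sw)).
  by have [_ ->] := cvg_limn_einf_sup lc.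
Qed.

Let D := Om `&` [set x | u x < w x].

Let mu_ : measurable_fun setT u := lf_measurable lf T0.
Let mw_ : measurable_fun setT w := lf_measurable lf TT.

Let mD : measurable D.
Proof.
by apply: measurableI; [exact: lf_measurable_set lf|exact: measurable_set_lt].
Qed.

Let F_cont : continuous F.
Proof. by move=> z; apply: differentiable_continuous; exact/derivable1_diffP. Qed.

Lemma leaf_F_integrable t : 0 <= t <= T -> mu.-integrable Om (EFin \o (F \o V t)).
Proof.
move=> tT; apply: measurable_bounded_integrable.
- exact: lf_measurable_set lf.
- exact: leaf_set_measure_lty lf.
- apply: (measurable_funS measurableT) => //; apply: measurableT_comp.
    exact: continuous_measurable_fun.
  exact: lf_measurable lf _ tT.
have M0 := lf_M_ge0 lf.
have cF : {within `[- M, M], continuous F} by exact: continuous_subspaceT.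
have MM : - M <= M by lra.
have [a _ ha] := EVT_max MM cF; have [b _ hb] := EVT_min MM cF.
exists (`|F a| + `|F b|); split; first exact: num_real.
move=> z /ltW hz y Oy /=; apply: le_trans hz.
have [b0 bT] := lf_bounded lf Oy; have /andP[t0 t1] := tT.
have h1 : u y <= V t y by apply: (lf_nondecreasing lf).
have h2 : V t y <= w y by apply: (lf_nondecreasing lf).
have yM : V t y \in `[- M, M].
  rewrite in_itv/=; move: b0 bT; rewrite !ler_norml => /andP[? ?] /andP[? ?].
  by apply/andP; split; lra.
have Fa := le_trans (ha _ yM) (ler_norm (F a)).
have Fb : - F (V t y) <= `|F b|.
  by rewrite -normrN; apply: le_trans (ler_norm _); rewrite lerN2; exact: hb.
have := normr_ge0 (F a); have := normr_ge0 (F b).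
by move=> ? ?; rewrite ler_norml; apply/andP; split; lra.
Qed.

Let cst_int (b : R) : mu.-integrable D (EFin \o cst b).
Proof.
apply: measurable_bounded_integrable => //.
- apply: le_lt_trans (leaf_set_measure_lty lf).
  apply: le_measure; rewrite ?inE; [exact: mD|exact: lf_measurable_set lf|].
  by move=> x [].
- by exists `|b|; split; [exact: num_real|move=> z /ltW bz x _ /=].
Qed.

Let FV_int t : 0 <= t <= T -> mu.-integrable D (EFin \o (F \o V t)).
Proof.
move=> tT; apply: integrableS (leaf_F_integrable tT) => //; first exact: lf_measurable_set lf.
by move=> x [].
Qed.

Let Fd : R := fine (\int[mu]_(x in Om) (F (w x))%:E) - fine (\int[mu]_(x in Om) (F (u x))%:E).

Let FdiffE : mu.-integrable D (EFin \o (fun x => F (w x) - F (u x))) /\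
  (\int[mu]_(x in D) (F (w x) - F (u x))%:E = Fd%:E)%E.
Proof.
have mOm := lf_measurable_set lf.
have E : EFin \o (fun x => F (w x) - F (u x)) =
  ((EFin \o (F \o w)) \- (EFin \o (F \o u)))%E by apply/funext.
split; first by rewrite E; apply: integrableB => //; exact: FV_int.
transitivity (\int[mu]_(x in Om) (F (w x) - F (u x))%:E)%E.
  rewrite integral_mkcond [RHS]integral_mkcond; apply: eq_integral => x _.
  rewrite !patchE /D in_setI; case: (boolP (x \in Om)) => //= Ox.
  case: ifPn => // /negP ux; congr EFin; apply/esym/eqP; rewrite subr_eq0; apply/eqP.
  congr F; apply/eqP; rewrite eq_le (lf_uw lf) andbT leNgt.
  by apply/negP => h; apply: ux; rewrite inE.
transitivity (\int[mu]_(x in Om) ((F (w x))%:E - (F (u x))%:E))%E => //.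
have iw := leaf_F_integrable TT; have iu := leaf_F_integrable T0.
rewrite (integralB_EFin mOm iw iu) /Fd EFinB.
by rewrite (fineK (integrable_fin_num mOm iw)) (fineK (integrable_fin_num mOm iu)).
Qed.

Let Ak k : R := fine (\int[mu]_x (leaf_energy Om T V tau p (e_ k) x)%:E).

Let hkE k : mu.-integrable D (EFin \o hk k) /\
  (\int[mu]_(x in D) (hk k x)%:E = (c * Ak k - Fd)%:E)%E.
Proof.
have int := leaf_energy_integrable lf p_itv (e_gt0 k) tail_u.
have intD := integrableS measurableT mD (@subsetT _ D) int.
have cint := integrableZl mD c intD.
have [fint fval] := FdiffE.
have E : EFin \o hk k = ((fun x => c%:E * (EFin \o leaf_energy Om T V tau p (e_ k)) x) \-
    (EFin \o (fun x => (F (w x) - F (u x))%R)))%E by apply/funext.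
split; first by rewrite E; exact: integrableB.
transitivity (\int[mu]_(x in D) ((fun x => c%:E * (EFin \o leaf_energy Om T V tau p (e_ k)) x) \-
    (EFin \o (fun x => (F (w x) - F (u x))%R))) x)%E => //.
rewrite (integralB mD cint fint) (integralZl mD intD) fval [RHS]EFinB EFinM.
congr (_ * _ - _)%E.
rewrite /Ak fineK; last exact: integrable_fin_num int.
rewrite integral_mkcond; apply: eq_integral => x _; rewrite patchE.
case: ifPn => // /negP xD; congr EFin; apply/esym.
have [Ox|Ox] := pselect (Om x); last exact: leaf_energy_exterior lf _ _ _ Ox.
have [_] := leaf_energyE lf p_itv (e_gt0 k) tail_u Ox.
rewrite set_itv_ge ?integral_set0; first by case.
by rewrite bnd_simp -leNgt leNgt; apply/negP => uw; apply: xD; rewrite inE.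
Qed.

Let hk_le k x : D x -> hk k x <= `|c * B| * (2 * M) - (F (w x) - F (u x)).
Proof.
move=> [Ox _]; rewrite lerD2r.
have [_ val] := leaf_energyE lf p_itv (e_gt0 k) tail_u Ox.
have h : (\int[lambda]_(l in `]u x, w x[%classic) leaf_trunc V tau p (e_ k) x l <=
    \int[lambda]_(l in `]u x, w x[%classic) `|B|%:E)%E.
  apply: le_integral_pointwise => l /(sweptE Ox) sw.
  by apply: le_trans (pv_le sw (e_itv k)) _; rewrite lee_fin ler_norm.
move: h; rewrite val integral_cst//= lebesgue_measure_itv/= lte_fin.
have [] := lf_bounded lf Ox; rewrite !ler_norml => /andP[? ?] /andP[? ?].
rewrite normrM (gtr0_norm c_gt0) -mulrA => h.
apply: ler_wpM2l; first exact: ltW.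
move: h; case: ifPn => _.
  rewrite -EFinB -EFinM lee_fin => h; apply: le_trans h _.
  by apply: ler_wpM2l => //; lra.
rewrite mule0 lee_fin => h; apply: le_trans h _.
by rewrite !mulr_ge0// (lf_M_ge0 lf).
Qed.

(** The calibration inequality for a leaf field whose truncated operators converge
and are bounded from above. *)
Lemma leaf_energy_inequality : (energy_full u < +oo)%E ->
  ((c / 4)%:E * energy_full w - \int[mu]_(x in Om) (F (w x))%:E <=
   (c / 4)%:E * energy_full u - \int[mu]_(x in Om) (F (u x))%:E +
   \int[mu]_(x in D) \int[lambda]_(l in `]u x, w x]%classic) G x l)%E.
Proof.
move=> Eu; have mOm := lf_measurable_set lf.
set RHS := (\int[mu]_(x in D) _)%E.
have fatou_hk : (limn_esup (fun k => \int[mu]_(x in D) (hk k x)%:E) <= RHS)%E.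
  apply: (@reverse_fatou _ _ _ mu D mD hk (fun x => `|c * B| * (2 * M) - (F (w x) - F (u x)))).
  - have [fint _] := FdiffE.
    rewrite (_ : _ \o _ = ((EFin \o cst (`|c * B| * (2 * M))%R) \-
      (EFin \o (fun x => (F (w x) - F (u x))%R)))%E); last by apply/funext.
    exact: integrableB.
  - by move=> k; have [] := hkE k.
  - by move=> k x; exact: hk_le.
  - by move=> x [Ox _]; exact: inner_le.
have Eu_ge0 : (0 <= energy_full u)%E.
  by apply: integral_ge0 => q _; rewrite lee_fin energy_term_ge0.
have Eufin : energy_full u \is a fin_num by rewrite ge0_fin_numE.
have Eku k : (energy_trunc Om p (e_ k) u < +oo)%E.
  exact: le_lt_trans (energy_trunc_le _ _) Eu.
have var k := energy_trunc_variation lf p_itv (e_gt0 k) tail_u (Eku k).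
have trunc_ge0 v k : (0 <= energy_trunc Om p (e_ k) v)%E.
  by apply: integral_ge0 => q _; rewrite lee_fin mulr_ge0 ?sqr_ge0 ?riesz_trunc_ge0.
have mono k0 k : (k0 <= k)%N ->
    (energy_trunc Om p (e_ k0) w <= energy_trunc Om p (e_ k) w)%E.
  move=> kk; apply: le_integral_pointwise => q _.
  rewrite lee_fin ler_wpM2l ?sqr_ge0//; apply: riesz_trunc_le.
  by rewrite ler_pM2l// lef_pV2 ?posrE// ler_nat.
have step k0 : ((c / 4)%:E * energy_trunc Om p (e_ k0) w <=
    ((c / 4) * fine (energy_full u) + Fd)%:E + RHS)%E.
  have fin0 : energy_trunc Om p (e_ k0) w \is a fin_num.
    by rewrite var fin_numD; apply/andP; split => //; rewrite ge0_fin_numE.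
  rewrite -leeBlDl// -(fineK fin0) -EFinM -EFinB.
  apply: le_trans fatou_hk; apply: (@le_limn_esup _ _ _ k0) => k kk.
  have [_ ->] := hkE k; rewrite lee_fin.
  have h1 := mono k0 k kk.
  have h2 : (energy_trunc Om p (e_ k) u <= energy_full u)%E by exact: energy_trunc_le.
  have fu : energy_trunc Om p (e_ k) u \is a fin_num by rewrite ge0_fin_numE.
  move: h1 h2; rewrite (var k) -(fineK fin0) -(fineK fu) -(fineK Eufin) -EFinD !lee_fin /=.
  rewrite -/(Ak k) => h1 h2.
  have : (c / 4) * fine (energy_trunc Om p (e_ k0) w) <=
      (c / 4) * (fine (energy_full u) + 4 * Ak k).
    by rewrite ler_pM2l ?divr_gt0//; lra.
  by lra.
have lim : ((c / 4)%:E * energy_full w <=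
    ((c / 4) * fine (energy_full u) + Fd)%:E + RHS)%E.
  have cvg_w : ((c / 4)%:E * energy_trunc Om p (e_ k) w)%E @[k --> \oo] -->
      ((c / 4)%:E * energy_full w)%E.
    by apply: cvgeZl => //; exact: energy_trunc_cvg.
  by apply: cvge_le cvg_w; apply: nearW => k; exact: step.
have iw := integrable_fin_num mOm (leaf_F_integrable TT).
have iu := integrable_fin_num mOm (leaf_F_integrable T0).
rewrite leeBlDr//; apply: le_trans lim _.
rewrite -[X in ((c / 4)%:E * X - _ + _ + _)%E](fineK Eufin).
rewrite /Fd; move: iw iu; rewrite /=.
case: (\int[mu]_(x in Om) (F (w x))%:E)%E => [a||]//= _.
case: (\int[mu]_(x in Om) (F (u x))%:E)%E => [b||]//= _.
rewrite -EFinM -EFinB [X in (_ <= X)%E]addeAC -EFinD.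
by apply: leeD2r; rewrite lee_fin; lra.
Qed.

End energy_inequality.


(** * From a weak field to a leaf field *)

Lemma within_continuous_comp_sub (X Y Z : topologicalType) (A : set Y) (B : set X)
    (f : Y -> Z) (phi : X -> Y) :
  {within A, continuous f} -> continuous phi -> (forall x, B x -> A (phi x)) ->
  {within B, continuous (f \o phi)}.
Proof.
move=> /subspace_continuousP cf cphi BA; apply/subspace_continuousP => x Bx.
apply: cvg_comp (cf _ (BA _ Bx)) => P /= AP.
have := cphi x _ AP; rewrite /nbhs /=; apply: filterS => z /= Pz Bz.
exact/Pz/BA.
Qed.

Lemma bounded_set_closure (R : realType) n (A : set 'rV[R]_n) :
  bounded_set A -> bounded_set (closure A).
Proof.
move=> [M [Mr MA]]; exists M; split => // r Mr' x Ax.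
pose C := [set y : 'rV[R]_n | `|y| <= r].
have cC : closed C.
  rewrite (_ : C = (fun y : 'rV[R]_n => `|y|) @^-1` [set z | z <= r])//.
  by apply: preimage_closed (@closed_le _ _) => y _; exact: norm_continuous.
have /closure_id CE := cC.
suff : closure C x by rewrite -CE.
by move: Ax; apply: closureS => y Ay; exact: MA.
Qed.

(** A compact set inside an open one has a uniform Euclidean neighbourhood. *)
Lemma compact_uniform_radius (R : realType) n (K N : set 'rV[R]_n) :
  compact K -> open N -> K `<=` N ->
  exists2 r : R, 0 < r & forall x y, K x -> enorm (x - y) <= r -> N y.
Proof.
move=> cK oN KN.
have near : \forall r \near (0 : R)^'+, K `<=` (fun x => forall y, enorm (x - y) <= r -> N y).
  have /compact_near_coveringP := cK; apply => x Kx.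
  have /nbhs_ballP[d /= d0 dN] : nbhs x N by apply: open_nbhs_nbhs; split => //; exact: KN.
  have d20 : 0 < d / 2 by rewrite divr_gt0.
  exists (ball x (d / 2), [set r : R | r < d / 2]) => /=.
    by split; [exact: nbhsx_ballx|exact: nbhs_right_lt].
  move=> [x' r] [/= xx' rd] y xy; apply: dN.
  rewrite -ball_normE/= /ball_/=.
  move: xx'; rewrite -ball_normE/= /ball_/= => xx'.
  rewrite [d]splitr -(subrKA x'); apply: le_lt_trans (ler_normD _ _) _.
  apply: ltrD => //; apply: le_lt_trans (norm_le_enorm _) _.
  exact: le_lt_trans rd.
have pos : \forall r \near (0 : R)^'+, 0 < r by exact: nbhs_right_gt.
have [r [r0 Kr]] := filter_ex (filterI pos near).
by exists r => // x y Kx; exact: Kr.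
Qed.

Section weak_field_theory.
Context {R : realType} {n : nat}.
Variables (Om : set 'rV[R]_n) (T : R) (u : 'rV[R]_n -> R).
Variable U : R -> 'rV[R]_n -> R.
Hypothesis dOm : domain Om.
Hypothesis bOm : bounded_set Om.
Hypothesis T_ge0 : 0 <= T.
Hypothesis U_field : weak_field Om T u U.
Local Notation mu := (lebesgue_rV n).
Implicit Types (x y : 'rV[R]_n) (t : R).

Let U_mono t1 t2 x : 0 <= t1 -> t1 <= t2 -> t2 <= T -> U t1 x <= U t2 x.
Proof. by move=> t10 t12 t2T; have [h _ _ _ _] := U_field; exact: h. Qed.

Let U_cont : {within closure Om `*` `[0, T]%classic,
  continuous (fun q : 'rV[R]_n * R => U q.2 q.1)}.
Proof. by have [] := U_field. Qed.

Let oOm : open Om. Proof. by case: dOm. Qed.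

Lemma weak_field_continuous_time x : Om x -> {within `[0, T], continuous (U ^~ x)}.
Proof.
move=> Ox; apply: (within_continuous_comp_sub (phi := fun t => (x, t)) U_cont).
  by move=> t; exact: (@cvg_pair _ _ _ (nbhs t) (nbhs x) (nbhs t) _ _ _ (fun=> x) id (cvg_cst x) cvg_id).
by move=> t tT; split => //=; exact: subset_closure.
Qed.

Lemma weak_field_continuous_space t : 0 <= t <= T -> {within closure Om, continuous (U t)}.
Proof.
move=> tT; apply: (within_continuous_comp_sub (phi := fun x => (x, t)) U_cont).
  by move=> x; exact: (@cvg_pair _ _ _ (nbhs x) (nbhs x) (nbhs t) _ _ _ id (fun=> t) cvg_id (cvg_cst t)).
by move=> x Ox; split => //=; rewrite in_itv.
Qed.

Lemma weak_field_bounded : exists2 M, 0 <= M & forall x, Om x ->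
  [/\ `|x| <= M, `|U 0 x| <= M & `|U T x| <= M].
Proof.
have cO : compact (closure Om).
  by apply: bounded_closed_compact; [exact: bounded_set_closure|exact: closed_closure].
have bd t : 0 <= t <= T -> exists M, forall x, Om x -> `|U t x| <= M.
  move=> tT; have := continuous_compact (weak_field_continuous_space tT) cO.
  move=> /compact_bounded[M [_ HM]]; exists (M + 1) => x Ox.
  by apply: HM; [rewrite ltrDl|exists x => //; exact: subset_closure].
have [|M0 HM0] := bd 0; first by rewrite lexx.
have [|MT HMT] := bd T; first by rewrite T_ge0 lexx.
have [Mx [_ HMx]] := bOm.
exists (`|M0| + `|MT| + `|Mx| + 1) => [|x Ox]; first by rewrite !addr_ge0.
have h0 := le_trans (HM0 x Ox) (ler_norm M0).
have hT := le_trans (HMT x Ox) (ler_norm MT).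
have hx : `|x| <= `|Mx| + 1.
  by apply: HMx => //; have := ler_norm Mx; lra.
have := normr_ge0 M0; have := normr_ge0 MT; have := normr_ge0 Mx.
by split; lra.
Qed.

(* A value above the initial one is taken only once; this is where the strict
   monotonicity of the field is used. *)
Let leaf_time_uniq x t1 t2 : Om x -> 0 <= t1 <= T -> 0 <= t2 <= T ->
  U 0 x < U t1 x -> U t1 x = U t2 x -> t1 = t2.
Proof.
move=> Ox /andP[t10 t1T] /andP[t20 t2T] h e.
have [_ _ _ _ [C0 _ /(_ x Ox)[inc _]]] := U_field.
have I t : 0 <= t -> t <= T -> U t x = U t1 x -> closure (leaf_times T U x) t.
  move=> t0 tT et; apply: subset_closure; split; last by rewrite et.
  rewrite tT andbT lt_def t0 andbT; apply/negP => /eqP t00.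
  by move: h; rewrite -et t00 ltxx.
have I1 := I t1 t10 t1T erefl; have I2 := I t2 t20 t2T (esym e).
have [lt|lt|//] := ltgtP t1 t2.
- by have := inc _ _ I1 I2 lt; rewrite e ltxx.
- by have := inc _ _ I2 I1 lt; rewrite e ltxx.
Qed.

Lemma leaf_parameterP x l : Om x -> U 0 x < l < U T x ->
  0 < leaf_parameter T U x l < T /\ U (leaf_parameter T U x l) x = l.
Proof.
move=> Ox /andP[l0 lT].
have [|t] := IVT T_ge0 (weak_field_continuous_time Ox) (v := l).
  by rewrite ge_min le_max (ltW l0) (ltW lT) orbT.
rewrite in_itv/= => /andP[t0 tT] Ut.
have := @xgetPex _ 0 [set t | 0 < t <= T /\ U t x = l].
rewrite -/(leaf_parameter T U x l) /= => -[|/andP[p0 pT] Up].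
  exists t; split => //; rewrite tT andbT lt_def t0 andbT.
  by apply/negP => /eqP t00; move: l0; rewrite -Ut t00 ltxx.
split => //; rewrite p0 lt_neqAle pT andbT.
by apply/negP => /eqP pT'; move: lT; rewrite -Up pT' ltxx.
Qed.

Let leaf_param_cmp x l q : Om x -> U 0 x < l < U T x -> 0 <= q <= T ->
  ((q < leaf_parameter T U x l) = (U q x < l)) *
  ((leaf_parameter T U x l < q) = (l < U q x)).
Proof.
move=> Ox xl /andP[q0 qT]; have [/andP[p0 pT] Up] := leaf_parameterP Ox xl.
set p := leaf_parameter T U x l in p0 pT Up *.
have l0 : U 0 x < U p x by rewrite Up; case/andP: xl.
have pI : 0 <= p <= T by rewrite !ltW.
have qI : 0 <= q <= T by rewrite q0.
have [lt|gt|->] := ltgtP q p; last by rewrite Up ltxx.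
- have le : U q x <= l by rewrite -Up; apply: U_mono => //; exact: ltW.
  have ne : U q x != l.
    apply/eqP => e; have := leaf_time_uniq Ox pI qI l0 (etrans Up (esym e)).
    by move=> pq; move: lt; rewrite pq ltxx.
  by rewrite lt_neqAle ne le ltNge le.
- have le : l <= U q x by rewrite -Up; apply: U_mono => //; exact: ltW.
  have ne : l != U q x.
    apply/eqP => e; have := leaf_time_uniq Ox pI qI l0 (etrans Up e).
    by move=> pq; move: gt; rewrite pq ltxx.
  by rewrite [l < _]lt_neqAle ne le ltNge le.
Qed.

Variable g : 'rV[R]_n -> R.
Hypothesis mg : measurable_fun setT g.
Hypothesis ug : {ae mu, forall x, u x = g x}.

(** A Borel modification of the leaves: unchanged on [Om], and given outside by
the Borel representative [g] of the initial function. *)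
Definition borel_leaf t x : R := if x \in Om then U t x else g x.

Lemma borel_leaf_in t x : Om x -> borel_leaf t x = U t x.
Proof. by move=> Ox; rewrite /borel_leaf mem_set. Qed.

Lemma borel_leaf_ae t : 0 <= t <= T -> {ae mu, forall x, U t x = borel_leaf t x}.
Proof.
move=> tT; have [_ _ /(_ t tT) h _ _] := U_field.
apply: filterS2 h ug => x Ux ugx; rewrite /borel_leaf; case: ifPn => // /negP Ox.
by rewrite Ux// => Ox'; apply: Ox; rewrite inE.
Qed.

Lemma measurable_borel_leaf t : 0 <= t <= T -> measurable_fun setT (borel_leaf t).
Proof.
move=> tT; have mOm : measurable Om by exact: open_measurable_rV.
have mU : measurable_fun Om (U t).
  apply: (measurability _ (RGenOInfty.measurableE R)) => _ [_ [a ->] <-].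
  apply: open_measurable_rV; rewrite openE => x /= [Ox]; rewrite in_itv/= andbT => aU.
  have near_x : \forall y \near x, closure Om y -> a < U t y.
    have /subspace_continuousP cU := weak_field_continuous_space tT.
    apply: (cU x (subset_closure Ox) [set z | a < z]).
    by apply: open_nbhs_nbhs; split => //; exact: open_gt.
  have near_Om : \forall y \near x, Om y by exact: open_nbhs_nbhs.
  near=> y.
  have Oy : Om y by near: y.
  split => //=; rewrite in_itv/= andbT.
  have h : closure Om y -> a < U t y by near: y.
  by apply: h; exact: subset_closure.
rewrite (_ : borel_leaf t = (U t \_ Om) \+ (g \_ (~` Om))); last first.
  apply/funext => x /=; rewrite /borel_leaf !patchE in_setC.
  by case: ifPn => _ /=; rewrite ?addr0 ?add0r.
apply: measurable_funD; first exact/(measurable_restrictT _ mOm).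
apply/(measurable_restrictT _ (measurableC mOm)).
exact: measurable_funS mg.
Unshelve. all: by end_near. Qed.

Lemma weak_field_leaf_field : exists M,
  leaf_field Om T M borel_leaf (leaf_parameter T U).
Proof.
have [M M0 HM] := weak_field_bounded; exists M; split => //.
- exact: open_measurable_rV.
- by move=> x /HM[].
- exact: measurable_borel_leaf.
- by move=> t y _ Oy; rewrite /borel_leaf memNset.
- by move=> t1 t2 y t10 t12 t2T; rewrite /borel_leaf; case: ifP => // _; exact: U_mono.
- move=> t y a /andP[t0 tT] aV.
  have [Oy|Oy] := pselect (Om y); last first.
    exists 0; first by rewrite rmorph0 lexx.
    by move: aV; rewrite /borel_leaf memNset.
  move: aV; rewrite borel_leaf_in// => aU.
  have tI : `[0, T]%classic t by rewrite /= in_itv/= (ltW t0).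
  have [d /= d0 dU] : \forall t' \near t, `[0, T]%classic t' -> a < U t' y.
    have /subspace_continuousP cU := weak_field_continuous_time Oy.
    apply: (cU t tI [set z | a < z]).
    by apply: open_nbhs_nbhs; split => //; exact: open_gt.
  have lt : Num.max 0 (t - d) < t by rewrite gt_max t0/= ltrBlDr ltrDl.
  have [q] := rat_in_itvoo lt; rewrite in_itv/= => /andP[].
  rewrite gt_max => /andP[q0 qd] qt; exists q; first by rewrite ltW.
  rewrite borel_leaf_in//; apply: dU => /=; last by rewrite in_itv/= !ltW// (lt_le_trans qt).
  by rewrite ger0_norm ?subr_ge0 ?(ltW qt)//; move: qd; lra.
- by move=> y Oy; rewrite !borel_leaf_in//; have [_ ] := HM y Oy.
- move=> x l Ox; rewrite !borel_leaf_in// => xl.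
  exact: leaf_parameterP.
- move=> x l q Ox; rewrite !borel_leaf_in// => xl qT.
  by rewrite (leaf_param_cmp Ox xl qT).
- move=> x l q Ox; rewrite !borel_leaf_in// => xl qT.
  by rewrite (leaf_param_cmp Ox xl qT).
Qed.

Lemma frac_laplacian_borel_leaf (c s : R) t x : 0 <= t <= T -> Om x ->
  frac_laplacian c s (U t) x =
  (c%:E * lim (pv_trunc (n%:R + 2 * s) (borel_leaf t) x e @[e --> (0 : R)^'+]))%E.
Proof.
move=> tT Ox.
have -> : pv_trunc (n%:R + 2 * s) (borel_leaf t) x = fun e =>
    (\int[mu]_(y in [set y | (e < enorm (x - y))%R])
      ((U t x - U t y) / enorm (x - y) `^ (n%:R + 2 * s))%:E)%E.
  apply/funext => e; apply/esym/ae_eq_integral_pointwise.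
  by apply: filterS (borel_leaf_ae tT) => y Uy _; rewrite Uy (borel_leaf_in t Ox).
by [].
Qed.

Lemma energy_borel_leaf (c s : R) t : 0 <= t <= T ->
  energy c s Om (U t) =
  ((c / 4)%:E * energy_full Om (n%:R + 2 * s) (borel_leaf t))%E.
Proof.
move=> tT; congr (_ * _)%E; apply: ae_eq_integral_pointwise.
have [N [mN N0 hN]] := borel_leaf_ae tT.
exists ((N `*` setT) `|` (setT `*` N)); split.
- by apply: measurableU; apply: measurableX.
- have e1 : (mu \x mu)%E (N `*` setT) = 0%E 
    by rewrite product_measure1E// [X in (X * _)%E](N0 : lebesgue_rV n N = 0%E) mul0e.
  have e2 : (mu \x mu)%E (setT `*` N) = 0%E 
    by rewrite product_measure1E// [X in (_ * X)%E](N0 : lebesgue_rV n N = 0%E) mule0.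
  by apply: null_set_setU => //; exact: measurableX.
(* The leaf and its Borel modification agree outside the null set [N], so the
   integrands can differ only where a coordinate lies in [N]. *)
- move=> [x y] /= /not_implyP[_ h].
  have [Nx|Nx] := pselect (N x); first by left.
  have [Ny|Ny] := pselect (N y); first by right.
  exfalso; apply: h; rewrite /riesz.
  by congr (`|_ - _| ^+ 2 / _)%:E; apply: contrapT => hne; [apply: Nx|apply: Ny]; exact: hN.
Qed.

End weak_field_theory.


(** Regularity from below yields, around every point where a leaf has moved, a
paraboloid touching it from below, with uniform opening and radius. *)
Lemma regular_by_below_paraboloid (R : realType) n (Om : set 'rV[R]_n) (T : R)
    (U : R -> 'rV[R]_n -> R) : bounded_set Om -> regular_by_below Om T U ->
  exists C r : R, [/\ 0 < C, 0 < r & forall t x, 0 < t < T -> Om x -> U 0 x < U t x ->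
    exists D : 'I_n -> R, {ae lebesgue_rV n, forall y, enorm (x - y) <= r ->
      U t x + \sum_(i < n) (y - x) ord0 i * D i - C * enorm (x - y) ^+ 2 <= U t y}].
Proof.
move=> bOm [C [N [C_gt0 [oN _ _] _ ON reg]]].
have cO : compact (closure Om).
  by apply: bounded_closed_compact; [exact: bounded_set_closure|exact: closed_closure].
have [r r0 Nr] := compact_uniform_radius cO oN ON.
exists C, r; split => // t x tT Ox Ut.
have [psi [C2psi psix psi_le hess]] := reg t x tT Ox Ut.
exists (fun i => partial i psi x); apply: filterS psi_le => y psiy xy.
have Ny z : enorm (x - z) <= r -> N z by apply: Nr; exact: subset_closure.
apply: le_trans (psiy (Ny y xy)); rewrite -psix enormB -{3}(subrKC x y).
apply: C2_taylor_ge C2psi (ltW C_gt0) hess _ => // k /andP[k0 k1].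
apply: Ny; rewrite opprD addNKr enormN enormZ ger0_norm// enormB.
by apply: le_trans xy; rewrite ler_piMl ?enorm_ge0.
Qed.

Theorem theorem4p3 (R : realType) (n : nat) (n_gt0 : (0 < n)%N)
  (c s : R) (c_gt0 : 0 < c) (s_01 : 0 < s < 1)
  (Omega : set 'rV[R]_n) (dOmega : domain Omega) (bOmega : bounded_set Omega)
  (u : 'rV[R]_n -> R)
  (u_cont : {within closure Omega, continuous u}) (u_L1s : L1s s u)
  (T : R) (T_ge0 : 0 <= T) (U : R -> 'rV[R]_n -> R)
  (U_field : weak_field Omega T u U) (U_reg : regular_by_below Omega T U)
  (u_energy : (energy c s Omega u < +oo)%E)
  (F : R -> R) (F_der : forall z, derivable F z 1) (F_C1 : continuous (derive1 F)) :
  (energyF c s Omega F (U T) <=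
   energyF c s Omega F u +
   \int[lebesgue_rV n]_(x in Omega `&` [set x | (u x < U T x)%R])
     \int[lebesgue_measure]_(lam in `](u x), (U T x)]%classic)
       (let t := leaf_parameter T U x lam in
        frac_laplacian c s (U t) x - (derive1 F (U t x))%:E))%E.
Proof.
have [[[g mg ug] _] tail_u] := u_L1s.
have Uu : U 0 = u by case: U_field.
have T0 : 0 <= (0 : R) <= T by rewrite lexx.
have TT : 0 <= T <= T by rewrite T_ge0 lexx.
pose p := n%:R + 2 * s.
have p_itv : n%:R < p < n%:R + 2.
  by move: s_01 => /andP[s0 s1]; rewrite /p; apply/andP; split; lra.
have [M lf] := weak_field_leaf_field dOmega bOmega T_ge0 U_field mg.
set V := borel_leaf Omega U g in lf.
have Vin t x : Omega x -> V t x = U t x by exact: borel_leaf_in.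
have Vae t : 0 <= t <= T -> {ae lebesgue_rV n, forall x, U t x = V t x}.
  by move=> tI; exact: (borel_leaf_ae U_field ug tI).
have tail_V : (\int[lebesgue_rV n]_y (`|V 0%R y| / (1 + enorm y `^ p))%:E < +oo)%E.
  rewrite (_ : (\int[_]_y _)%E =
    (\int[lebesgue_rV n]_y (`|u y| / (1 + enorm y `^ (n%:R + 2 * s)))%:E)%E)//.
  apply: ae_eq_integral_pointwise; apply: filterS (Vae 0 T0) => y Vy _.
  by rewrite -Vy Uu.
have [C [r [C_gt0 r_gt0 touch]]] := regular_by_below_paraboloid bOmega U_reg.
have [C1 C1_ge0 pv] := pv_trunc_cvg p_itv.
have [B B_ge0 dom] := leaf_pv_dominated lf p_itv r_gt0 tail_V.
have pvP x l : swept Omega T V (x, l) ->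
    cvg (pv_trunc p (V (leaf_parameter T U x l)) x e @[e --> (0 : R)^'+]) /\
    forall e, 0 < e <= r -> (pv_trunc p (V (leaf_parameter T U x l)) x e <=
      (B + C * (C1 * r `^ (n%:R + 2 - p)))%:E)%E.
  move=> [/= Ox xl]; have [/andP[t0 tT] Vt] := lf_leaf lf Ox xl.
  move: t0 tT Vt; set t := leaf_parameter T U x l => t0 tT Vt.
  have tI : 0 <= t <= T by rewrite !ltW.
  have moved : U 0 x < U t x by rewrite -!Vin// Vt; case/andP: xl.
  have [|D touchD] := touch t x _ Ox moved; first by rewrite t0.
  have [|||cv le] := pv x (V t) D C r (ltW C_gt0) r_gt0.
  - exact: lf_measurable lf _ tI.
  - move=> e e_gt0; have [B' _ dome] := leaf_pv_dominated lf p_itv e_gt0 tail_V.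
    by have [] := dome x t Ox tI.
  - by apply: filterS2 (Vae t tI) touchD => y <-; rewrite Vin.
  - split => // e er; apply: le_trans (le e er) _; rewrite EFinD; apply: leeD2r.
    have [_ domr] := dom x t Ox tI; apply: le_trans domr.
    apply: le_trans (lee_abs _) (le_abse_integral _ _ _).
      exact: measurable_euclid_exterior.
    by have [/integrableP[]] := dom x t Ox tI.
pose G x l := (frac_laplacian c s (U (leaf_parameter T U x l)) x -
  (derive1 F (U (leaf_parameter T U x l) x))%:E)%E.
have GE x l : swept Omega T V (x, l) -> G x l =
    (c%:E * lim (pv_trunc p (V (leaf_parameter T U x l)) x e @[e --> (0 : R)^'+]) -
     (derive1 F l)%:E)%E.
  move=> sw; have tI := leaf_time_itv lf sw; case: sw => /= Ox xl.
  have [_ Vt] := lf_leaf lf Ox xl.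
  by rewrite /G (frac_laplacian_borel_leaf U_field ug)// -Vin// Vt.
have EVT : energy c s Omega (U T) = ((c / 4)%:E * energy_full Omega p (V T))%E.
  exact: (energy_borel_leaf U_field ug c s TT).
have EV0 : energy c s Omega u = ((c / 4)%:E * energy_full Omega p (V 0%R))%E.
  by rewrite -Uu; exact: (energy_borel_leaf U_field ug c s T0).
have Eu : (energy_full Omega p (V 0%R) < +oo)%E.
  move: u_energy; rewrite EV0; case: (energy_full _ _ _) => [e _|h|_]; rewrite ?ltry//.
  by move: h; rewrite gt0_muley// lte_fin divr_gt0.
have FVT : (\int[lebesgue_rV n]_(x in Omega) (F (V T x))%:E =
    \int[lebesgue_rV n]_(x in Omega) (F (U T x))%:E)%E.
  by apply: eq_integral => x /set_mem Ox; rewrite Vin.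
have FV0 : (\int[lebesgue_rV n]_(x in Omega) (F (V 0%R x))%:E =
    \int[lebesgue_rV n]_(x in Omega) (F (u x))%:E)%E.
  by apply: eq_integral => x /set_mem Ox; rewrite Vin// Uu.
have sweepE : (\int[lebesgue_rV n]_(x in Omega `&` [set x | (V 0%R x < V T x)%R])
      \int[lebesgue_measure]_(l in `](V 0%R x), (V T x)]%classic) G x l =
    \int[lebesgue_rV n]_(x in Omega `&` [set x | (u x < U T x)%R])
      \int[lebesgue_measure]_(l in `](u x), (U T x)]%classic) G x l)%E.
  rewrite (_ : Omega `&` [set x | V 0 x < V T x] = Omega `&` [set x | u x < U T x]).
    by apply: eq_integral => x /set_mem[Ox _]; rewrite !Vin// Uu.
  by apply/seteqP; split => x /= [Ox]; rewrite !Vin// Uu.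
have main := leaf_energy_inequality lf p_itv tail_V r_gt0 (fun x l sw => (pvP x l sw).1)
  (fun x l e sw => (pvP x l sw).2 e) c_gt0 F_der F_C1 GE Eu.
rewrite FVT FV0 sweepE -EVT -EV0 in main.
exact: main.
Qed.
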